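(* Let $\mathcal{A}$ be a set with $|\mathcal{A}|=2$. Then for any $\lambda\ge 0$ and for either choice $\text{Fair-viol}\in\{\text{DP-viol},\text{EO-viol}\}$, given a dataset $\mathcal{D}=((x_i,y_i,a_i))_{i=1}^n\subseteq\mathbb{R}^d\times[k]\times\mathcal{A}$, a scoring function $s:\mathbb{R}^d\to\mathbb{R}$ and a cost matrix $C\in\mathbb{R}_{\ge 0}^{k\times k}$, one can find in time $\mathcal{O}(n^6k^3)$ thresholds $\boldsymbol\theta=(\theta_1,\dots,\theta_{k-1})$ with $\theta_1\le\dots\le\theta_{k-1}$ that are optimal for $$\min_{\boldsymbol\theta}\ \frac1n\sum_{i=1}^n C_{y_i,f(x_i;s,\boldsymbol\theta)}+\lambda\cdot\text{Fair-viol}(f(\cdot\,;s,\boldsymbol\theta);\mathcal{D}).$$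
   Context: $[k]=\{1,\dots,k\}$. For a scoring function $s$ and thresholds $\theta_1\le\dots\le\theta_{k-1}$, the threshold-model predictor $f(\cdot\,;s,\boldsymbol\theta):\mathbb{R}^d\to[k]$ predicts label $i$ for $x$ iff $s(x)\in(\theta_{i-1},\theta_i]$, where $\theta_0=-\infty$, $\theta_k=+\infty$. The cost matrix $C$ has zero diagonal and V-shaped rows: $C_{i,i}=0$, $C_{i,j-1}\ge C_{i,j}$ for $2\le j\le i$, and $C_{i,j}\le C_{i,j+1}$ for $i\le j\le k-1$. For a predictor $f$, with $(x_1,y_1,a_1),(x_2,y_2,a_2)$ independent uniform samples (with replacement) from $\mathcal{D}$, $$\text{DP-viol}(f;\mathcal{D})=\max_{\tilde a,\hat a\in\mathcal{A}}\big|\mathbb{P}[f(x_1)>f(x_2)\mid a_1=\tilde a,a_2=\hat a]-\mathbb{P}[f(x_1)<f(x_2)\mid a_1=\tilde a,a_2=\hat a]\big|,$$ $$\text{EO-viol}(f;\mathcal{D})=\max_{\tilde a,\hat a\in\mathcal{A}}\big|\mathbb{P}[f(x_1)>f(x_2)\mid a_1=\tilde a,a_2=\hat a,y_1>y_2]-\mathbb{P}[f(x_1)<f(x_2)\mid a_1=\tilde a,a_2=\hat a,y_1<y_2]\big|.$$ Cost model: arithmetic operations and comparisons on real numbers take unit time; the values $s(x_1),\dots,s(x_n)$ are given, i.e. the time for evaluating $s$ is not counted. *)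

(* Defs.v *)
From mathcomp Require Import all_boot all_order all_algebra.
From mathcomp Require Import reals constructive_ereal.

Set Implicit Arguments.
Unset Strict Implicit.
Unset Printing Implicit Defensive.

Import Order.TTheory GRing.Theory Num.Theory.
Local Open Scope ring_scope.

(* There are k = m.+1 labels and m thresholds.  Everything is numbered from 0:
   the label l : 'I_m.+1 is the label l + 1 of [k], and theta j is
   theta_(j + 1).  The function [bound theta] is theta_0, ..., theta_k, with
   theta_0 = -oo and theta_k = +oo. *)
Definition bound (R : realType) (m : nat) (theta : 'I_m -> R) (i : nat) :
    \bar R :=
  if i is j.+1 then
    if insub j is Some j' then (theta j')%:E else +oo%E
  else -oo%E.

(* For a nondecreasing theta the selected label exists and is unique
   ([threshold_predictP]), so the default value of [odflt] is not used. *)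
Definition threshold_predict (R : realType) (T : Type) (m : nat)
    (s : T -> R) (theta : 'I_m -> R) (x : T) : 'I_m.+1 :=
  odflt ord0
    [pick i : 'I_m.+1 | (bound theta i < (s x)%:E <= bound theta i.+1)%E].

Definition nondecreasing_thresholds (R : realType) (m : nat)
    (theta : 'I_m -> R) : Prop :=
  forall i j : 'I_m, (i <= j)%N -> theta i <= theta j.

Lemma bound_le (R : realType) (m : nat) (theta : 'I_m -> R) (i j : nat) :
  nondecreasing_thresholds theta -> (i <= j)%N ->
  (bound theta i <= bound theta j)%E.
Proof.
move=> th; case: i => [|i]; first by rewrite leNye.
case: j => // j; rewrite ltnS /bound => ij.
case: insubP => [i' _ iE|ni]; last first.
  case: insubP => [j' jm _|_]; last exact: lexx.
  by rewrite (leq_ltn_trans ij jm) in ni.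
case: insubP => [j' _ jE|_]; last exact: leey.
by rewrite lee_fin; apply: th; rewrite iE jE.
Qed.

Lemma threshold_predictP (R : realType) (T : Type) (m : nat) (s : T -> R)
    (theta : 'I_m -> R) (x : T) (i : 'I_m.+1) :
  nondecreasing_thresholds theta ->
  (threshold_predict s theta x == i) =
  (bound theta i < (s x)%:E <= bound theta i.+1)%E.
Proof.
move=> th; rewrite /threshold_predict; case: pickP => [l /= lP|no].
  apply/eqP/idP => [<- //|iP]; apply/val_inj.
  case: (ltngtP (val l) (val i)) => // lt_li.
    case/andP: lP => _ lP; case/andP: iP => iP _.
    have := le_lt_trans (le_trans lP (bound_le th lt_li)) iP.
    by rewrite ltxx.
  case/andP: lP => lP _; case/andP: iP => _ iP.
  have := le_lt_trans (le_trans iP (bound_le th lt_li)) lP.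
  by rewrite ltxx.
have ex : exists l, ((s x)%:E <= bound theta l.+1)%E.
  by exists m; rewrite /bound insubF ?leey // ltnn.
have lem : (ex_minn ex < m.+1)%N.
  case: ex_minnP => l _ /(_ m); rewrite ltnS; apply.
  by rewrite /bound insubF ?leey // ltnn.
have := no (Ordinal lem) => /=; case: ex_minnP => [[|l] -> min] /=.
  by rewrite ltNyr.
rewrite andbT => /negbT; rewrite -leNgt => /min.
by rewrite ltnn.
Qed.

Definition V_shaped_cost_matrix (R : realType) (k : nat) (C : 'M[R]_k) :
    Prop :=
  [/\ forall i : 'I_k, C i i = 0,
      forall i j j' : 'I_k, val j' = j.+1 -> (j' <= i)%N -> C i j' <= C i j
    & forall i j j' : 'I_k, val j' = j.+1 -> (i <= j)%N -> C i j <= C i j'].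

Definition dataset (R : realType) (d k : nat) (A : finType) (n : nat) : Type :=
  n.-tuple ('rV[R]_d * 'I_k * A).

Section Data.
Context (R : realType) (d k : nat) (A : finType) (n : nat).
Implicit Types (D : dataset R d k A n) (i : 'I_n).
Definition feature D i : 'rV[R]_d := (tnth D i).1.1.
Definition label D i : 'I_k := (tnth D i).1.2.
Definition group D i : A := (tnth D i).2.
End Data.

(* Two independent uniform samples with replacement from a dataset of size n
   are a uniformly distributed pair of indices. *)
Definition Pr2 (R : realType) (n : nat) (E : {set 'I_n * 'I_n}) : R :=
  #|E|%:R / (n ^ 2)%:R.

(* As x / 0 = 0, a probability conditional on a null event is 0. *)
Definition condPr2 (R : realType) (n : nat) (E F : {set 'I_n * 'I_n}) : R :=
  Pr2 R (E :&: F) / Pr2 R F.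

Definition DP_viol (R : realType) (d k : nat) (A : finType) (n : nat)
    (f : 'rV[R]_d -> 'I_k) (D : dataset R d k A n) : R :=
  let x := feature D in let a := group D in
  \big[Num.max/0]_(p : A * A)
   `| condPr2 R [set z | (f (x z.1) > f (x z.2))%N]
                [set z | (a z.1 == p.1) && (a z.2 == p.2)]
    - condPr2 R [set z | (f (x z.1) < f (x z.2))%N]
                [set z | (a z.1 == p.1) && (a z.2 == p.2)] |.

Definition EO_viol (R : realType) (d k : nat) (A : finType) (n : nat)
    (f : 'rV[R]_d -> 'I_k) (D : dataset R d k A n) : R :=
  let x := feature D in let y := label D in let a := group D in
  \big[Num.max/0]_(p : A * A)
   `| condPr2 R [set z | (f (x z.1) > f (x z.2))%N]
                [set z | [&& a z.1 == p.1, a z.2 == p.2 & (y z.1 > y z.2)%N]]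
    - condPr2 R [set z | (f (x z.1) < f (x z.2))%N]
                [set z | [&& a z.1 == p.1, a z.2 == p.2 & (y z.1 < y z.2)%N]] |.

Inductive fairness : Set := DP | EO.

Definition fair_viol (v : fairness) (R : realType) (d k : nat) (A : finType)
    (n : nat) (f : 'rV[R]_d -> 'I_k) (D : dataset R d k A n) : R :=
  match v with DP => DP_viol f D | EO => EO_viol f D end.

Definition objective (v : fairness) (R : realType) (d m : nat) (A : finType)
    (n : nat) (lambda : R) (D : dataset R d m.+1 A n) (s : 'rV[R]_d -> R)
    (C : 'M[R]_m.+1) (theta : 'I_m -> R) : R :=
  let f := threshold_predict s theta in
  n%:R^-1 * (\sum_(i < n) C (label D i) (f (feature D i)))
    + lambda * fair_viol v f D.

Definition optimal_thresholds (v : fairness) (R : realType) (d m : nat)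
    (A : finType) (n : nat) (lambda : R) (D : dataset R d m.+1 A n)
    (s : 'rV[R]_d -> R) (C : 'M[R]_m.+1) (theta : 'I_m -> R) : Prop :=
  nondecreasing_thresholds theta /\
  forall theta' : 'I_m -> R, nondecreasing_thresholds theta' ->
    objective v lambda D s C theta <= objective v lambda D s C theta'.

(* Memory of a unit-cost real RAM: arrays of natural numbers and arrays of real
   numbers, named by numbers, unbounded, and indexed from 0. *)
Record memory (R : realType) : Type := Memory {
  nat_mem : nat -> nat -> nat;
  real_mem : nat -> nat -> R }.

Definition store (T : Type) (h : nat -> nat -> T) (b i : nat) (v : T) :
    nat -> nat -> T :=
  fun b' i' => if (b' == b) && (i' == i) then v else h b' i'.

(* Array names are constants of the program, array indices are computed. *)
Inductive nexp : Set :=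
| NConst of nat
| NGet of nat & nexp
| NAdd of nexp & nexp
| NSub of nexp & nexp
| NMul of nexp & nexp.

Inductive rexp : Set :=
| ROfNat of nexp
| RGet of nat & nexp
| RAdd of rexp & rexp
| RSub of rexp & rexp
| RMul of rexp & rexp
| RDiv of rexp & rexp.

Inductive bexp : Set :=
| NLe of nexp & nexp
| RLe of rexp & rexp
| BNot of bexp
| BAnd of bexp & bexp.

Inductive prog : Set :=
| Skip
| NSet of nat & nexp & nexp
| RSet of nat & nexp & rexp
| Seq of prog & prog
| If of bexp & prog & prog
| While of bexp & prog.

Fixpoint neval (R : realType) (h : memory R) (e : nexp) : nat :=
  match e with
  | NConst q => q
  | NGet b i => nat_mem h b (neval h i)
  | NAdd e1 e2 => neval h e1 + neval h e2
  | NSub e1 e2 => neval h e1 - neval h e2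
  | NMul e1 e2 => neval h e1 * neval h e2
  end%N.

Fixpoint reval (R : realType) (h : memory R) (e : rexp) : R :=
  match e with
  | ROfNat e1 => (neval h e1)%:R
  | RGet b i => real_mem h b (neval h i)
  | RAdd e1 e2 => reval h e1 + reval h e2
  | RSub e1 e2 => reval h e1 - reval h e2
  | RMul e1 e2 => reval h e1 * reval h e2
  | RDiv e1 e2 => reval h e1 / reval h e2
  end.

Fixpoint beval (R : realType) (h : memory R) (e : bexp) : bool :=
  match e with
  | NLe e1 e2 => (neval h e1 <= neval h e2)%N
  | RLe e1 e2 => reval h e1 <= reval h e2
  | BNot e1 => ~~ beval h e1
  | BAnd e1 e2 => beval h e1 && beval h e2
  end.

(* Every constant, memory access, operation and comparison costs one unit. *)
Fixpoint ncost (e : nexp) : nat :=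
  match e with
  | NConst _ => 1
  | NGet _ i => (ncost i).+1
  | NAdd e1 e2 | NSub e1 e2 | NMul e1 e2 => (ncost e1 + ncost e2).+1
  end.

Fixpoint rcost (e : rexp) : nat :=
  match e with
  | ROfNat e1 => (ncost e1).+1
  | RGet _ i => (ncost i).+1
  | RAdd e1 e2 | RSub e1 e2 | RMul e1 e2 | RDiv e1 e2 =>
      (rcost e1 + rcost e2).+1
  end.

Fixpoint bcost (e : bexp) : nat :=
  match e with
  | NLe e1 e2 => (ncost e1 + ncost e2).+1
  | RLe e1 e2 => (rcost e1 + rcost e2).+1
  | BNot e1 => (bcost e1).+1
  | BAnd e1 e2 => (bcost e1 + bcost e2).+1
  end.

(* [exec p h t h'] : started in memory h, the program p halts after exactly t
   time units in memory h'. *)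
Inductive exec (R : realType) :
    prog -> memory R -> nat -> memory R -> Prop :=
| exec_skip h : exec Skip h 1 h
| exec_nset b i e h :
    exec (NSet b i e) h (ncost i + ncost e).+1
      (Memory (store (nat_mem h) b (neval h i) (neval h e)) (real_mem h))
| exec_rset b i e h :
    exec (RSet b i e) h (ncost i + rcost e).+1
      (Memory (nat_mem h) (store (real_mem h) b (neval h i) (reval h e)))
| exec_seq p q h h1 h2 t1 t2 :
    exec p h t1 h1 -> exec q h1 t2 h2 -> exec (Seq p q) h (t1 + t2)%N h2
| exec_if e p q h h' t :
    exec (if beval h e then p else q) h t h' ->
    exec (If e p q) h (bcost e + t).+1 h'
| exec_while_stop e p h :
    ~~ beval h e -> exec (While e p) h (bcost e).+1 h
| exec_while_step e p h h1 h2 t1 t2 :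
    beval h e -> exec p h t1 h1 -> exec (While e p) h1 t2 h2 ->
    exec (While e p) h (bcost e + t1 + t2).+1 h2.

Lemma exec_det (R : realType) (p : prog) (h h1 h2 : memory R) (t1 t2 : nat) :
  exec p h t1 h1 -> exec p h t2 h2 -> t1 = t2 /\ h1 = h2.
Proof.
move=> e1; elim: e1 t2 h2 => {p h t1 h1}.
- by move=> h t2 h2 e2; inversion e2.
- by move=> b i e h t2 h2 e2; inversion e2.
- by move=> b i e h t2 h2 e2; inversion e2.
- move=> p q h h1 h3 t1 t3 _ IH1 _ IH3 t2 h2 e2; inversion e2 as
    [| | |? ? ? h4 ? ? ? E1 E3| | |]; subst.
  have [-> E] := IH1 _ _ E1; rewrite -E in E3.
  by have [-> ->] := IH3 _ _ E3.
- move=> e p q h h' t _ IH t2 h2 e2; inversion e2 as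
    [| | | |? ? ? ? ? ? E1| |]; subst.
  by have [-> ->] := IH _ _ E1.
- move=> e p h ne t2 h2 e2; inversion e2 as
    [| | | | | |? ? ? ? ? ? ? be]; subst => //.
  by rewrite be in ne.
- move=> e p h h1 h3 t1 t3 be _ IH1 _ IH3 t2 h2 e2; inversion e2 as
    [| | | | |? ? ? ne|? ? ? h4 ? ? ? be' E1 E3]; subst.
    by rewrite be in ne.
  have [-> E] := IH1 _ _ E1; rewrite -E in E3.
  by have [-> ->] := IH3 _ _ E3.
Qed.

Definition arrays (T : Type) (x0 : T) (ls : seq (seq T)) : nat -> nat -> T :=
  fun b i => nth x0 (nth [::] ls b) i.

(* Input: natural array 0 holds n and k, array 1 the labels, array 2 the groups
   (as positions in the enumeration of A); real array 0 holds lambda, array 1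
   the scores s(x_i), array 2 the matrix C in row-major order.  All other cells
   are 0. *)
Definition input_memory (R : realType) (d k : nat) (A : finType) (n : nat)
    (lambda : R) (D : dataset R d k A n) (s : 'rV[R]_d -> R) (C : 'M[R]_k) :
    memory R :=
  Memory
    (arrays 0%N [:: [:: n; k];
                    [seq val (label D i) | i <- enum 'I_n];
                    [seq val (enum_rank (group D i)) | i <- enum 'I_n]])
    (arrays 0 [:: [:: lambda];
                  [seq s (feature D i) | i <- enum 'I_n];
                  [seq C i j | i <- enum 'I_k, j <- enum 'I_k]]).

(* Output: real array 3. *)
Definition output_thresholds (R : realType) (m : nat) (h : memory R) :
    'I_m -> R :=
  fun j => real_mem h 3 j.

(* Main.v *)
Require Import Defs.
From mathcomp Require Import all_boot all_order all_algebra.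
From mathcomp Require Import reals constructive_ereal.
From mathcomp Require Import zify lra.

(** Moving a threshold within a gap of the score values does not change the
    predictions on the data, so thresholds may be chosen among n + 2 candidates:
    the scores and two values below and above all of them.  The cost is additive
    over the blocks between consecutive thresholds.  For two groups, both
    violations are |P / Z1 - Q / Z2|, where P (resp. Q) counts the pairs in which
    the point with the larger prediction is in the first (resp. second) group,
    for EO only among pairs whose labels are ordered in the same way.  Only
    pairs in different blocks count, so P and Q too are sums of contributions
    which depend only on the two thresholds that bound a block.  With
    W = n^2 + 1 > P, Q, the pair is the single number q = P W + Q, and dynamic
    programming over (number of thresholds set, last candidate, q) finds the
    least cost for every q; the time is dominated by k n^2 W^2 relaxations, each
    of which copies a list of k thresholds.  A final scan over P and Q selects
    the optimum. *)

Set Implicit Arguments.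
Unset Strict Implicit.
Unset Printing Implicit Defensive.

Import Order.TTheory GRing.Theory Num.Theory.
Local Open Scope ring_scope.

(** * A language of bounded loops, its semantics and its running time *)

(** [sem] fixes the number of rounds of a loop on entry, so it is a total function, and running
    times can be bounded by recursion on the syntax. *)
Inductive cmd : Set :=
| CSkip
| CNSet of nat & nexp & nexp
| CRSet of nat & nexp & rexp
| CSeq of cmd & cmd
| CIf of bexp & cmd & cmd
| CFor of nat & nexp & cmd.

Local Notation var x := (NGet x (NConst 0)).
Local Notation rvar x := (RGet x (NConst 0)).

Definition for_test (x : nat) (e : nexp) : bexp := BNot (NLe e (var x)).
Definition incr (x : nat) : prog := NSet x (NConst 0) (NAdd (var x) (NConst 1)).

(** The compiled loop evaluates its bound anew in every test, whereas [sem] evaluates it once;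
    [well_formed] makes the two agree. *)
Fixpoint compile (c : cmd) : prog :=
  match c with
  | CSkip => Skip
  | CNSet b i e => NSet b i e
  | CRSet b i e => RSet b i e
  | CSeq c1 c2 => Seq (compile c1) (compile c2)
  | CIf e c1 c2 => If e (compile c1) (compile c2)
  | CFor x e c1 =>
      Seq (NSet x (NConst 0) (NConst 0))
          (While (for_test x e) (Seq (compile c1) (incr x)))
  end.

Definition nset (R : realType) (h : memory R) (b i v : nat) : memory R :=
  Memory (store (nat_mem h) b i v) (real_mem h).
Definition rset (R : realType) (h : memory R) (b i : nat) (v : R) : memory R :=
  Memory (nat_mem h) (store (real_mem h) b i v).

Fixpoint sem (R : realType) (c : cmd) (h : memory R) : memory R :=
  match c with
  | CSkip => h
  | CNSet b i e => nset h b (neval h i) (neval h e)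
  | CRSet b i e => rset h b (neval h i) (reval h e)
  | CSeq c1 c2 => sem c2 (sem c1 h)
  | CIf e c1 c2 => if beval h e then sem c1 h else sem c2 h
  | CFor x e c1 =>
      iter (neval h e)
        (fun h1 => let h2 := sem c1 h1 in nset h2 x 0 (nat_mem h2 x 0 + 1))
        (nset h x 0 0)
  end.

Fixpoint nat_writes (c : cmd) : seq nat :=
  match c with
  | CNSet b _ _ => [:: b]
  | CSkip | CRSet _ _ _ => [::]
  | CSeq c1 c2 | CIf _ c1 c2 => nat_writes c1 ++ nat_writes c2
  | CFor x _ c1 => x :: nat_writes c1
  end.

Fixpoint real_writes (c : cmd) : seq nat :=
  match c with
  | CSkip | CNSet _ _ _ => [::]
  | CRSet b _ _ => [:: b]
  | CSeq c1 c2 | CIf _ c1 c2 => real_writes c1 ++ real_writes c2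
  | CFor _ _ c1 => real_writes c1
  end.

(* Bounds in which only n and k, that is, natural array 0, are read. *)
Fixpoint static (e : nexp) : bool :=
  match e with
  | NConst _ | NGet 0 (NConst 0) | NGet 0 (NConst 1) => true
  | NAdd e1 e2 | NMul e1 e2 => static e1 && static e2
  | _ => false
  end.

(** Natural array 0 is never written, so a static bound keeps its value while its loop runs; the
    body also leaves the loop counter alone. *)
Fixpoint well_formed (c : cmd) : bool :=
  match c with
  | CNSet b _ _ => b != 0%N
  | CSkip | CRSet _ _ _ => true
  | CSeq c1 c2 | CIf _ c1 c2 => well_formed c1 && well_formed c2
  | CFor x e c1 =>
      [&& x != 0%N, static e, x \notin nat_writes c1 & well_formed c1]
  end.

Arguments sem : simpl never.

(** * Frame property and loop rule *)

Section Frame.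
Variable R : realType.
Implicit Types (h : memory R) (c : cmd).

Definition agree c h h' : Prop :=
  (forall b i, b \notin nat_writes c -> nat_mem h' b i = nat_mem h b i) /\
  (forall b i, b \notin real_writes c -> real_mem h' b i = real_mem h b i).

Lemma storeE T (a : nat -> nat -> T) b i v b' i' :
  store a b i v b' i' = if (b' == b) && (i' == i) then v else a b' i'.
Proof. by []. Qed.

Lemma sem_skip h : sem CSkip h = h. Proof. by []. Qed.
Lemma sem_nset b i e h : sem (CNSet b i e) h = nset h b (neval h i) (neval h e).
Proof. by []. Qed.
Lemma sem_rset b i e h : sem (CRSet b i e) h = rset h b (neval h i) (reval h e).
Proof. by []. Qed.
Lemma sem_seq c1 c2 h : sem (CSeq c1 c2) h = sem c2 (sem c1 h).
Proof. by []. Qed.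
Lemma sem_if e c1 c2 h :
  sem (CIf e c1 c2) h = if beval h e then sem c1 h else sem c2 h.
Proof. by []. Qed.
Lemma sem_for x e c h :
  sem (CFor x e c) h =
  iter (neval h e)
    (fun h1 => let h2 := sem c h1 in nset h2 x 0 (nat_mem h2 x 0 + 1))
    (nset h x 0 0).
Proof. by []. Qed.

Lemma sem_agree c h : agree c h (sem c h).
Proof.
elim: c h => [|b i e|b i e|c1 IH1 c2 IH2|e c1 IH1 c2 IH2|x e c1 IH] h.
- by [].
- split=> [b' i'|//]; rewrite sem_nset /= inE => /negbTE nb.
  by rewrite storeE nb.
- split=> [//|b' i']; rewrite sem_rset /= inE => /negbTE nb.
  by rewrite storeE nb.
- have [n1 r1] := IH1 h; have [n2 r2] := IH2 (sem c1 h).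
  split=> b i; rewrite sem_seq /= mem_cat negb_or => /andP[n1' n2'].
    by rewrite n2 // n1.
  by rewrite r2 // r1.
- have [n1 r1] := IH1 h; have [n2 r2] := IH2 h.
  split=> b i; rewrite sem_if /= mem_cat negb_or => /andP[n1' n2']; case: ifP => _;
  by rewrite ?n1 ?n2 ?r1 ?r2.
- rewrite /agree sem_for /=; elim: (neval h e) => [|N [IHn IHr]].
    by split=> b i //=; rewrite storeE inE negb_or => /andP[/negbTE->].
  split=> b i /= nb.
    rewrite storeE; move: (nb); rewrite inE negb_or => /andP[/negbTE-> /= nb'].
    by rewrite (IH _).1 // IHn.
  by rewrite (IH _).2 // IHr.
Qed.

(** Every round is given [agree] with the memory on entry, so an invariant has to mention only the
    arrays that the body changes. *)
Lemma for_inv (I : nat -> memory R -> Prop) x e N c h :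
  neval h e = N -> x \notin nat_writes c ->
  I 0%N (nset h x 0 0) ->
  (forall i h1, (i < N)%N -> nat_mem h1 x 0 = i ->
     agree (CFor x e c) h h1 -> I i h1 -> I i.+1 (nset (sem c h1) x 0 i.+1)) ->
  I N (sem (CFor x e c) h).
Proof.
move=> eN xc I0 IS; rewrite sem_for eN.
suff H i : (i <= N)%N ->
  let h1 := iter i (fun h1 => let h2 := sem c h1 in
               nset h2 x 0 (nat_mem h2 x 0 + 1)) (nset h x 0 0) in
  [/\ nat_mem h1 x 0 = i, agree (CFor x e c) h h1 & I i h1].
  by have [] := H N (leqnn _).
elim: i => [_|i IH iN] h1.
  split=> //=; first by rewrite storeE !eqxx.
  by split=> b j //=; rewrite storeE inE negb_or => /andP[/negbTE->].
have [xi ag Ii] := IH (ltnW iN).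
have xi1 : h1 = nset (sem c (iter i (fun h1 => let h2 := sem c h1 in
               nset h2 x 0 (nat_mem h2 x 0 + 1)) (nset h x 0 0))) x 0 i.+1.
  by rewrite /h1 /= (sem_agree _ _).1 // xi addn1.
rewrite xi1; split; first by rewrite /= storeE !eqxx.
  split=> b j nb.
    move: (nb); rewrite /= storeE inE negb_or => /andP[/negbTE-> /= nb'].
    by rewrite (sem_agree _ _).1 // ag.1.
  by rewrite /= (sem_agree _ _).2 // ag.2.
exact: IS.
Qed.
End Frame.

(* (q, a, b) stands for the monomial bound q n^a k^b. *)
Definition monomial : Set := nat * nat * nat.
Definition mval (x : monomial) (n k : nat) : nat := x.1.1 * (n ^ x.1.2 * k ^ x.2).
Definition mconst (q : nat) : monomial := (q, 0, 0)%N.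
(** Adding coefficients and taking the larger exponents bounds a sum of monomials from above once n
    and k are positive. *)
Definition madd (x y : monomial) : monomial :=
  (x.1.1 + y.1.1, maxn x.1.2 y.1.2, maxn x.2 y.2)%N.
Definition mmul (x y : monomial) : monomial :=
  (x.1.1 * y.1.1, x.1.2 + y.1.2, x.2 + y.2)%N.

Fixpoint static_bound (e : nexp) : monomial :=
  match e with
  | NConst q => mconst q
  | NGet 0 (NConst 0) => (1, 1, 0)%N
  | NGet 0 (NConst 1) => (1, 0, 1)%N
  | NAdd e1 e2 => madd (static_bound e1) (static_bound e2)
  | NMul e1 e2 => mmul (static_bound e1) (static_bound e2)
  | _ => mconst 0
  end.

(** A loop costs 3 for resetting the counter, one failing test, and in each round a successful test,
    6 for the increment, and the body. A conditional is charged for both branches. *)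
Fixpoint time_bound (c : cmd) : monomial :=
  match c with
  | CSkip => mconst 1
  | CNSet _ i e => mconst (ncost i + ncost e).+1
  | CRSet _ i e => mconst (ncost i + rcost e).+1
  | CSeq c1 c2 => madd (time_bound c1) (time_bound c2)
  | CIf e c1 c2 =>
      madd (mconst (bcost e).+1) (madd (time_bound c1) (time_bound c2))
  | CFor x e c1 =>
      madd (mconst ((bcost (for_test x e)).+1 + 3))
        (mmul (static_bound e)
           (madd (mconst ((bcost (for_test x e)).+1 + 6)) (time_bound c1)))
  end.

(** * Running time of compiled commands *)

Section Time.
Variables (R : realType) (n k : nat).
Hypotheses (n_gt0 : (0 < n)%N) (k_gt0 : (0 < k)%N).
Implicit Types (h : memory R) (c : cmd).

Lemma mval_const q : mval (mconst q) n k = q.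
Proof. by rewrite /mval !expn0 !muln1. Qed.

Lemma mval_mul x y : mval (mmul x y) n k = (mval x n k * mval y n k)%N.
Proof. by rewrite /mval /= !expnD [RHS]mulnACA; congr muln; exact: mulnACA. Qed.

Lemma mval_add x y : (mval x n k + mval y n k <= mval (madd x y) n k)%N.
Proof.
rewrite /mval /= mulnDl; apply: leq_add; rewrite leq_mul2l; apply/orP; right;
  by apply: leq_mul; apply: leq_pexp2l; rewrite // (leq_maxl, leq_maxr).
Qed.

Lemma static_leq e h : static e -> nat_mem h 0 0 = n -> nat_mem h 0 1 = k ->
  (neval h e <= mval (static_bound e) n k)%N.
Proof.
move=> + hn hk; elim: e => //=.
- by move=> q _; rewrite mval_const.
- by case=> // -[] // [|[|q]] // _ _ /=; rewrite ?hn ?hk /mval /= mul1n expn0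
    expn1 (muln1, mul1n).
- move=> e1 IH1 e2 IH2 /andP[/IH1 l1 /IH2 l2].
  exact: leq_trans (leq_add l1 l2) (mval_add _ _).
- move=> e1 IH1 e2 IH2 /andP[/IH1 l1 /IH2 l2].
  by rewrite mval_mul; apply: leq_mul.
Qed.

Lemma static_eq e h h' : static e -> (forall i, nat_mem h 0 i = nat_mem h' 0 i) ->
  neval h e = neval h' e.
Proof.
move=> + E; elim: e => //=.
- by case=> // -[] // [|[|q]] // _ _ /=; rewrite E.
- by move=> e1 IH1 e2 IH2 /andP[/IH1 -> /IH2 ->].
- by move=> e1 IH1 e2 IH2 /andP[/IH1 -> /IH2 ->].
Qed.

Lemma nat0_notin_writes c : well_formed c -> 0%N \notin nat_writes c.
Proof.
elim: c => //=.
- by move=> b _ _ nb; rewrite inE eq_sym.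
- by move=> c1 IH1 c2 IH2 /andP[/IH1 n1 /IH2 n2]; rewrite mem_cat negb_or n1.
- by move=> e c1 IH1 c2 IH2 /andP[/IH1 n1 /IH2 n2]; rewrite mem_cat negb_or n1.
- by move=> x e c IH /and4P[x0 _ _ /IH nc]; rewrite inE negb_or eq_sym x0.
Qed.

Lemma compile_exec c h : well_formed c ->
  nat_mem h 0 0 = n -> nat_mem h 0 1 = k ->
  exists2 t, exec (compile c) h t (sem c h) & (t <= mval (time_bound c) n k)%N.
Proof.
elim: c h => [|b i e|b i e|c1 IH1 c2 IH2|e c1 IH1 c2 IH2|x e c IH] h.
- by move=> _ _ _; exists 1%N; [exact: exec_skip|rewrite mval_const].
- by move=> _ _ _; exists (ncost i + ncost e).+1; [exact: exec_nset
    |rewrite mval_const].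
- by move=> _ _ _; exists (ncost i + rcost e).+1; [exact: exec_rset
    |rewrite mval_const].
- move=> /= /andP[w1 w2] hn hk; have [t1 e1 l1] := IH1 h w1 hn hk.
  have n0 := nat0_notin_writes w1.
  have [||t2 e2 l2] := IH2 (sem c1 h) w2; rewrite ?(sem_agree _ _).1 //.
  exists (t1 + t2)%N; first exact: exec_seq e1 e2.
  exact: leq_trans (leq_add l1 l2) (mval_add _ _).
- move=> /= /andP[w1 w2] hn hk.
  have [t et lt] : exists2 t,
      exec (if beval h e then compile c1 else compile c2) h t
           (if beval h e then sem c1 h else sem c2 h)
      & (t <= mval (time_bound c1) n k + mval (time_bound c2) n k)%N.
    case: (beval h e); [have [t et lt] := IH1 h w1 hn hk
                       |have [t et lt] := IH2 h w2 hn hk]; exists t => //.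
      exact: leq_trans lt (leq_addr _ _).
    exact: leq_trans lt (leq_addl _ _).
  exists (bcost e + t).+1.
    by apply: exec_if.
  apply: leq_trans (mval_add _ _).
  rewrite mval_const addSn ltnS leq_add2l; exact: leq_trans lt (mval_add _ _).
- move=> wf hn hk; have /= /and4P[x0 se xc wc] := wf.
  set B := bcost (for_test x e); set T := mval (time_bound c) n k.
  set step := fun h1 : memory R =>
    let h2 := sem c h1 in nset h2 x 0 (nat_mem h2 x 0 + 1).
  (* Induction on the number N of rounds left, from any memory in which the bound is the counter
     plus N. *)
  have main N h1 : (neval h1 e = nat_mem h1 x 0 + N)%N ->
      nat_mem h1 0 0 = n -> nat_mem h1 0 1 = k ->
    exists2 t, exec (While (for_test x e) (Seq (compile c) (incr x))) h1 t
       (iter N step h1) & (t <= B.+1 + N * (B.+1 + 6 + T))%N.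
    elim: N h1 => [|N IHN] h1 eN h1n h1k.
      exists B.+1; last by rewrite addn0.
      by apply: exec_while_stop; rewrite /= negbK eN addn0.
    have [t1 e1 l1] := IH h1 wc h1n h1k.
    have n0 := nat0_notin_writes wc.
    have nx : (0 == x)%N = false by rewrite eq_sym (negbTE x0).
    have st0 i : nat_mem (step h1) 0 i = nat_mem h1 0 i.
      by rewrite /= storeE nx /= (sem_agree _ _).1.
    have [|||t2 e2 l2] := IHN (step h1).
    + rewrite (static_eq (h' := h1) se st0) /= storeE !eqxx /=.
      by rewrite (sem_agree _ _).1 // eN addn1 addSnnS.
    + by rewrite st0.
    + by rewrite st0.
    + exists (B + (t1 + 6) + t2).+1.
        rewrite iterSr; apply: exec_while_step e2.
          by rewrite /= eN -ltnNge addnS ltnS leq_addr.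
        apply: exec_seq e1 _; exact: (exec_nset x (NConst 0)).
      by rewrite mulSn; move: l1 l2; rewrite -/T; lia.
  have s0 i : nat_mem (nset h x 0 0) 0 i = nat_mem h 0 i.
    by rewrite /= storeE eq_sym (negbTE x0).
  have [|||t et lt] := main (neval h e) (nset h x 0 0).
  + by rewrite (static_eq (h' := h) se s0) /= storeE !eqxx.
  + by rewrite s0.
  + by rewrite s0.
  + exists (3 + t)%N.
      by apply: exec_seq et; exact: (exec_nset x (NConst 0) (NConst 0)).
    apply: leq_trans (mval_add _ _).
    rewrite mval_const -/B addnC -addnA (addnC 3) addnA leq_add2r.
    apply: leq_trans lt _; rewrite leq_add2l mval_mul.
    apply: leq_mul; first exact: static_leq.
    by apply: leq_trans (mval_add _ _); rewrite mval_const.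
Qed.
End Time.

(** * Sums over the blocks of a prediction *)

Definition in_block (R : realType) (a b x : R) : bool := (a < x) && (x <= b).

Section Blocks.
Variables (R : realType) (n k : nat) (s : nat -> R) (th : nat -> R) (f : nat -> nat).
Hypothesis th_le : forall i, (i < k)%N -> th i <= th i.+1.
Hypothesis fP : forall u, (u < n)%N ->
  (f u < k)%N && in_block (th (f u)) (th (f u).+1) (s u).

Lemma thresholds_le i j : (i <= j <= k)%N -> th i <= th j.
Proof.
case/andP=> ij; rewrite -(subnKC ij); elim: (j - i)%N => [|d IH]; first by rewrite addn0.
by rewrite addnS => dk; apply: le_trans (IH (ltnW dk)) (th_le dk).
Qed.

(** As [th] is nondecreasing, the block containing [s u] decides the comparison with every
    threshold. *)
Lemma le_threshold u j : (u < n)%N -> (j <= k)%N -> (s u <= th j) = (f u < j)%N.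
Proof.
move=> un jk; have /and3P[fk lo hi] := fP un.
case: ltnP => fj; first by apply: le_trans hi _; apply: thresholds_le; rewrite fj.
apply/negbTE; rewrite -ltNge; apply: le_lt_trans lo.
by apply: thresholds_le; rewrite fj ltnW.
Qed.

Lemma in_blockE u j : (u < n)%N -> (j < k)%N ->
  in_block (th j) (th j.+1) (s u) = (j == f u).
Proof.
move=> un jk; rewrite /in_block ltNge !le_threshold ?(ltnW jk) //.
by rewrite -leqNgt ltnS eqn_leq andbC andbC.
Qed.

(** The blocks partition the points: after the sums are exchanged, only the block [f u] contributes
    for the point u. *)
Lemma sum_blocks (V : nmodType) (F : nat -> nat -> V) :
  \sum_(0 <= j < k) \sum_(0 <= u < n | in_block (th j) (th j.+1) (s u)) F j u =
  \sum_(0 <= u < n) F (f u) u.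
Proof.
under eq_bigr do rewrite big_mkcond.
rewrite exchange_big /=; apply: eq_big_nat => u /andP[_ un].
have /andP[fk _] := fP un.
rewrite big_nat_cond (eq_bigr (fun j => if j == f u then F j u else 0)).
  by rewrite -big_nat_cond -big_mkcond big_nat1_eq fk.
by move=> j /andP[/andP[_ jk] _]; rewrite in_blockE.
Qed.
End Blocks.

(** * Costs and pair counts as sums of block contributions *)

Section Gain.
Variables (R : realType) (n : nat) (y g : nat -> nat) (s : nat -> R)
  (cost : nat -> nat -> R) (v : fairness).

Definition radix : nat := (n * n + 1)%N.

Definition comparable_pair (u w : nat) : bool :=
  if v is EO then (y w < y u)%N else true.

(** In both kinds of pairs, u stands for the point with the larger prediction; 0 and 1 are the
    positions of the groups in the enumeration of [A]. *)
Definition pos_pair (u w : nat) : bool :=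
  [&& g u == 0, g w == 1 & comparable_pair u w]%N.
Definition neg_pair (u w : nat) : bool :=
  [&& g u == 1, g w == 0 & comparable_pair u w]%N.

Definition gain (u w : nat) : nat := (radix * pos_pair u w + neg_pair u w)%N.

(** The points w with score at most a are those of the lower blocks, so pairs whose upper point is
    in this block are counted without knowing any threshold but a and b. *)
Definition delta (a b : R) : nat :=
  (\sum_(0 <= u < n | in_block a b (s u)) \sum_(0 <= w < n | (s w <= a)%R) gain u w)%N.

Definition kappa (j : nat) (a b : R) : R :=
  \sum_(0 <= u < n | in_block a b (s u)) cost u j.

Definition pair_count (p : nat -> nat -> bool) (f : nat -> nat) : nat :=
  (\sum_(0 <= u < n) \sum_(0 <= w < n | (f w < f u)%N) p u w)%N.

Lemma pair_count_lt p f : (pair_count p f < radix)%N.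
Proof.
rewrite /radix addn1 ltnS /pair_count big_mkord.
apply: leq_trans (_ : \sum_(u < n) n <= _)%N; last by rewrite sum_nat_const card_ord.
apply: leq_sum => u _; rewrite big_mkcond big_mkord.
apply: leq_trans (_ : \sum_(w < n) 1 <= _)%N; last by rewrite sum1_card card_ord.
by apply: leq_sum => w _; case: ifP => // _; exact: leq_b1.
Qed.

Section Path.
Variables (k : nat) (th : nat -> R) (f : nat -> nat).
Hypothesis th_le : forall i, (i < k)%N -> th i <= th i.+1.
Hypothesis fP : forall u, (u < n)%N ->
  (f u < k)%N && in_block (th (f u)) (th (f u).+1) (s u).

Lemma sum_kappa : \sum_(0 <= j < k) kappa j (th j) (th j.+1) =
  \sum_(0 <= u < n) cost u (f u).
Proof. by rewrite (sum_blocks th_le fP (fun j u => cost u j)). Qed.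

(** Each pair is charged to the block of its upper point u, because [s w <= th (f u)] holds exactly
    when [f w < f u]. The factor [radix] in [gain] keeps the two counts apart. *)
Lemma sum_delta : (\sum_(0 <= j < k) delta (th j) (th j.+1) =
  pair_count pos_pair f * radix + pair_count neg_pair f)%N.
Proof.
rewrite (sum_blocks th_le fP (fun j u => \sum_(0 <= w < n | (s w <= th j)%R) gain u w)%N).
rewrite /pair_count big_distrl -big_split /=; apply: eq_big_nat => u /andP[_ un].
have /andP[fk _] := fP un.
rewrite big_distrl -big_split /= big_nat_cond [RHS]big_nat_cond.
apply: eq_big => [w|w _]; last by rewrite /gain mulnC.
by case: (ltnP w n) => // wn; rewrite (le_threshold th_le fP) // ltnW.
Qed.
End Path.
End Gain.

(** * Candidates and block weights *)

(* Natural arrays: 3 flags of the table; loop counters 4, 5 (points), 6 (label),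
   7, 8 (consecutive candidates), 9 (q), 11 (copying), 16, 17 (P and Q);
   10 block weight; 12, 13 cells of the table; 14, 15 Z1 and Z2; 18 whether
   real array 3 holds a solution.
   Real arrays: 3 output; 4 candidates; 5, 6 costs and threshold lists of the
   table; 7 bound on the scores; 8 block cost; 9 best and 10 current value. *)
Local Notation "0n" := (NConst 0).
Local Notation "1n" := (NConst 1).
Local Notation size_n := (NGet 0 0n).
Local Notation size_k := (NGet 0 1n).
Local Notation radix_n := (NAdd (NMul size_n size_n) 1n).
Local Notation cands_n := (NAdd size_n (NConst 2)).
Local Notation y_ x := (NGet 1 (var x)).
Local Notation g_ x := (NGet 2 (var x)).
Local Notation s_ x := (RGet 1 (var x)).
Local Notation cand_ x := (RGet 4 (var x)).

Definition cell_n (j c q : nexp) : nexp :=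
  NAdd (NMul (NAdd (NMul q (NAdd size_k 1n)) j) cands_n) c.

(** The final flag enters the empty path, of weight 0, into cell 0 of the table; its cost is 0
    because that cell has never been written. *)
Definition init_cmd : cmd :=
  CSeq (CRSet 7 0n (ROfNat 0n))
  (CSeq (CFor 4 size_n
    (CRSet 7 0n (RAdd (rvar 7) (RAdd (ROfNat 1n) (RMul (s_ 4) (s_ 4))))))
  (CSeq (CRSet 4 0n (RSub (ROfNat 0n) (rvar 7)))
  (CSeq (CFor 4 size_n (CRSet 4 (NAdd (var 4) 1n) (s_ 4)))
  (CSeq (CRSet 4 (NAdd size_n 1n) (rvar 7))
        (CNSet 3 0n 1n))))).

Section Tests.
Variable v : fairness.

Definition comparable_test : bexp :=
  if v is EO then NLe (NAdd (y_ 5) 1n) (y_ 4) else NLe 0n 0n.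
Definition groups_test (x0 x1 : nat) : bexp :=
  BAnd (NLe (g_ x0) 0n) (BAnd (NLe 1n (g_ x1)) (NLe (g_ x1) 1n)).
Definition pos_test : bexp := BAnd (groups_test 4 5) comparable_test.
Definition neg_test : bexp := BAnd (groups_test 5 4) comparable_test.

(** For block weights both counters are the same cell, with increments [radix] and 1; for the totals
    Z1 and Z2 they are two cells with increment 1. *)
Definition count_pair (x1 : nat) (e1 : nexp) (x2 : nat) (e2 : nexp) : cmd :=
  CSeq (CIf pos_test (CNSet x1 0n (NAdd (var x1) e1)) CSkip)
       (CIf neg_test (CNSet x2 0n (NAdd (var x2) e2)) CSkip).

Definition gain_cmd : cmd :=
  CFor 5 size_n (CIf (RLe (s_ 5) (cand_ 7)) (count_pair 10 radix_n 10 1n) CSkip).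

Definition weights_cmd : cmd :=
  CSeq (CNSet 10 0n 0n)
  (CSeq (CRSet 8 0n (ROfNat 0n))
    (CFor 4 size_n
      (CIf (BAnd (BNot (RLe (s_ 4) (cand_ 7))) (RLe (s_ 4) (cand_ 8)))
        (CSeq (CRSet 8 0n (RAdd (rvar 8)
                 (RGet 2 (NAdd (NMul (y_ 4) size_k) (var 6)))))
              gain_cmd)
        CSkip))).
End Tests.

Lemma big_nat_recr_cond (T : Type) (idx : T) (op : Monoid.law idx) (i : nat)
    (P : pred nat) (F : nat -> T) :
  \big[op/idx]_(0 <= j < i.+1 | P j) F j =
  op (\big[op/idx]_(0 <= j < i | P j) F j) (if P i then F i else idx).
Proof. by rewrite big_mkcond big_nat_recr //= -big_mkcond. Qed.

(** * Correctness of the initialization and of the block weights *)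

Section Semantics.
Variables (R : realType) (v : fairness) (n k : nat) (y g : nat -> nat)
  (s C : nat -> R) (lambda : R).
Implicit Types h : memory R.

Record input_env h : Prop := InputEnv {
  env_n : nat_mem h 0 0 = n;
  env_k : nat_mem h 0 1 = k;
  env_y : forall u, nat_mem h 1 u = y u;
  env_g : forall u, nat_mem h 2 u = g u;
  env_lambda : real_mem h 0 0 = lambda;
  env_s : forall u, real_mem h 1 u = s u;
  env_C : forall u, real_mem h 2 u = C u }.

Definition keeps_input (c : cmd) : bool :=
  all (leq 3) (nat_writes c) && all (leq 3) (real_writes c).

Lemma input_env_agree c h h' :
  agree c h h' -> keeps_input c -> input_env h -> input_env h'.
Proof.
case=> an ar /andP[/allP kn /allP kr] [? ? ? ? ? ? ?].
have nn b : (b < 3)%N -> b \notin nat_writes c.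
  by rewrite ltnNge; apply: contra => /kn.
have nr b : (b < 3)%N -> b \notin real_writes c.
  by rewrite ltnNge; apply: contra => /kr.
by split=> *; rewrite ?an ?ar ?nn ?nr.
Qed.

Lemma input_env_sem c h : keeps_input c -> input_env h -> input_env (sem c h).
Proof. exact: input_env_agree (sem_agree c h). Qed.

(** Since 1 + t^2 > |t| for every real t, this is a strict bound on all |s u|, computed without any
    comparison. *)
Definition outer : R := \sum_(0 <= u < n) (1 + s u * s u).
Definition cand (c : nat) : R :=
  if c is u.+1 then if (u < n)%N then s u else outer else - outer.

Lemma outerP u : (u < n)%N -> - outer < s u <= outer.
Proof.
move=> un; have : 1 + s u * s u <= outer.
  rewrite /outer big_mkord (bigD1 (Ordinal un)) //= lerDl.
  by apply: sumr_ge0 => i _; rewrite addr_ge0 // -expr2 sqr_ge0.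
nra.
Qed.

Definition cand_env h : Prop :=
  forall c, (c < n + 2)%N -> real_mem h 4 c = cand c.

Lemma outer_spec h : input_env h -> real_mem h 7 0 = 0 ->
  real_mem (sem (CFor 4 size_n
    (CRSet 7 0n (RAdd (rvar 7) (RAdd (ROfNat 1n) (RMul (s_ 4) (s_ 4)))))) h) 7 0
  = outer.
Proof.
move=> env h0.
pose I i h1 := real_mem h1 7 0 = \sum_(0 <= u < i) (1 + s u * s u).
apply: (for_inv (I := I)) => //; first exact: env_n env.
  by rewrite /I big_geq.
move=> i h1 _ h1i ag Ii; have env1 := input_env_agree ag isT env.
by rewrite /I sem_rset /= storeE /= h1i !(env_s env1) big_nat_recr //= Ii.
Qed.

Lemma fill_spec h : input_env h ->
  let h1 := sem (CFor 4 size_n (CRSet 4 (NAdd (var 4) 1n) (s_ 4))) h in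
  real_mem h1 4 0 = real_mem h 4 0 /\
  (forall u, (u < n)%N -> real_mem h1 4 u.+1 = s u).
Proof.
move=> env.
pose I i h1 := real_mem h1 4 0 = real_mem h 4 0 /\
  (forall u, (u < i)%N -> real_mem h1 4 u.+1 = s u).
apply: (for_inv (I := I)) => //; first exact: env_n env.
move=> i h1 _ h1i ag [I0 Ii]; have env1 := input_env_agree ag isT env.
rewrite /I sem_rset /= !storeE h1i !(env_s env1) addn1; split=> // u.
rewrite ltnS storeE /= eqSS leq_eqVlt; case: eqP => [->//|_] /= ui.
exact: Ii.
Qed.

Lemma init_spec h : input_env h ->
  let h1 := sem init_cmd h in
  [/\ input_env h1, cand_env h1,
      forall x, nat_mem h1 3 x = if x == 0%N then 1%N else nat_mem h 3 x
    & agree init_cmd h h1].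
Proof.
move=> env h1; have ag : agree init_cmd h h1 by apply: sem_agree.
have env' := input_env_agree ag isT env.
split => //; rewrite /h1 /init_cmd !sem_seq sem_nset /=; last first.
  by move=> x; rewrite storeE /= !(sem_agree _ _).1.
set h2 := sem (CFor _ _ (CRSet 7 _ _)) _.
have env1 : input_env (sem (CRSet 7 0n (ROfNat 0n)) h) by exact: input_env_sem.
have env2 : input_env h2 by exact: input_env_sem.
have h2M : real_mem h2 7 0 = outer by rewrite outer_spec.
have env3 : input_env (sem (CRSet 4 0n (RSub (ROfNat 0n) (rvar 7))) h2).
  exact: input_env_sem.
have [] := fill_spec env3; have [_] := sem_agree
  (CFor 4 size_n (CRSet 4 (NAdd (var 4) 1n) (s_ 4)))
  (sem (CRSet 4 0n (RSub (ROfNat 0n) (rvar 7))) h2).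
have := input_env_agree (sem_agree
  (CFor 4 size_n (CRSet 4 (NAdd (var 4) 1n) (s_ 4)))
  (sem (CRSet 4 0n (RSub (ROfNat 0n) (rvar 7))) h2)) isT env3.
move: (sem _ (sem _ h2)) => h3 env4 ag3 e0 eu [|c] cn.
  by rewrite sem_rset /= storeE (env_n env4) addn1 /= e0 sem_rset /= storeE h2M sub0r.
rewrite sem_rset /= storeE (env_n env4) addn1 /= eqSS ag3 // sem_rset /= storeE /=.
rewrite h2M; case: ltnP => [cn'|nc]; first by rewrite ltn_eqF // eu.
by rewrite eqn_leq nc andbT; have -> : (c <= n)%N by lia.
Qed.

Lemma comparable_testE h : input_env h ->
  beval h (comparable_test v) =
  comparable_pair y v (nat_mem h 4 0) (nat_mem h 5 0).
Proof.
by move=> env; rewrite /comparable_test /comparable_pair; case: v => //=;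
  rewrite !(env_y env) addn1.
Qed.

Lemma bandE h e1 e2 : beval h (BAnd e1 e2) = beval h e1 && beval h e2.
Proof. by []. Qed.

Lemma groups_testE h x0 x1 : input_env h ->
  beval h (groups_test x0 x1) =
  (g (nat_mem h x0 0) == 0%N) && (g (nat_mem h x1 0) == 1%N).
Proof.
move=> env /=; rewrite !(env_g env) leqn0 (andbC (0 < _)%N).
by rewrite -(eqn_leq _ 1).
Qed.

Lemma pos_testE h : input_env h ->
  beval h (pos_test v) = pos_pair y g v (nat_mem h 4 0) (nat_mem h 5 0).
Proof.
move=> env; rewrite /pos_test bandE groups_testE // comparable_testE //.
by rewrite /pos_pair andbA.
Qed.

Lemma neg_testE h : input_env h ->
  beval h (neg_test v) = neg_pair y g v (nat_mem h 4 0) (nat_mem h 5 0).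
Proof.
move=> env; rewrite /neg_test bandE groups_testE // comparable_testE //.
by rewrite /neg_pair andbA (andbC (_ == 0)%N).
Qed.

Lemma count_if_spec h b x e :
  nat_mem (sem (CIf b (CNSet x 0n (NAdd (var x) e)) CSkip) h) x 0 =
  (nat_mem h x 0 + neval h e * beval h b)%N.
Proof.
rewrite sem_if; case: ifP => _; last by rewrite muln0 addn0.
by rewrite sem_nset /= storeE !eqxx muln1.
Qed.

Local Notation gain := (gain n y g v).
Local Notation delta := (delta n y g s v).
Local Notation kappa := (kappa n s (fun u j => C (y u * k + j)%N)).

Lemma gain_spec h c : input_env h -> cand_env h ->
  nat_mem h 7 0 = c -> (c < n + 2)%N ->
  nat_mem (sem (gain_cmd v) h) 10 0 =
  (nat_mem h 10 0 +
   \sum_(0 <= w < n | (s w <= cand c)%R) gain (nat_mem h 4 0) w)%N.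
Proof.
move=> env cenv hc cn.
pose I i h1 := nat_mem h1 10 0 = (nat_mem h 10 0 +
   \sum_(0 <= w < i | (s w <= cand c)%R) gain (nat_mem h 4 0) w)%N.
apply: (for_inv (I := I)) => //; first exact: env_n env.
  by rewrite /I big_geq // addn0.
move=> i h1 _ h1i ag Ii; have env1 := input_env_agree ag isT env.
have u1 : nat_mem h1 4 0 = nat_mem h 4 0 by rewrite ag.1.
rewrite /I big_nat_recr_cond addnA -Ii /= storeE.
rewrite sem_if /= env_s // h1i (ag.1 7%N) // hc ag.2 // cenv //.
case: ifP => _; last by rewrite addn0.
rewrite /count_pair sem_seq count_if_spec count_if_spec pos_testE // h1i u1.
set h2 := sem _ h1; have env2 : input_env h2 by exact: input_env_sem.
have [a2 _] : agree (CIf (pos_test v) (CNSet 10 0n (NAdd (var 10) radix_n)) CSkip) h1 h2.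
  exact: sem_agree.
rewrite neg_testE // !a2 // h1i u1 /= !(env_n env1) mul1n addnA.
by rewrite -addnA.
Qed.

Lemma weights_spec h j c c' : input_env h -> cand_env h ->
  nat_mem h 6 0 = j -> nat_mem h 7 0 = c -> nat_mem h 8 0 = c' ->
  (c < n + 2)%N -> (c' < n + 2)%N ->
  let h1 := sem (weights_cmd v) h in
  nat_mem h1 10 0 = delta (cand c) (cand c') /\
  real_mem h1 8 0 = kappa j (cand c) (cand c').
Proof.
move=> env cenv hj hc hc' cn cn' h1.
rewrite {}/h1 /weights_cmd !sem_seq.
set h0 := sem (CRSet _ _ _) _.
have env0 : input_env h0 by apply: input_env_sem => //; exact: input_env_sem.
have cenv0 : cand_env h0 by [].
pose I i h1 := nat_mem h1 10 0 = (\sum_(0 <= u < i | in_block (cand c) (cand c') (s u))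
     \sum_(0 <= w < n | (s w <= cand c)%R) gain u w)%N /\
  real_mem h1 8 0 = \sum_(0 <= u < i | in_block (cand c) (cand c') (s u)) C (y u * k + j).
apply: (for_inv (I := I)) => //; first exact: env_n env0.
  by split; rewrite big_geq.
move=> i h1 _ h1i ag [I1 I2]; have env1 := input_env_agree ag isT env0.
have cenv1 : cand_env h1 by move=> x xn; rewrite ag.2 // cenv0.
rewrite /I !big_nat_recr_cond -I1 -I2.
have c1 : nat_mem h1 7 0 = c by rewrite ag.1.
have c1' : nat_mem h1 8 0 = c' by rewrite ag.1.
have j1 : nat_mem h1 6 0 = j by rewrite ag.1.
rewrite sem_if /= env_s // h1i c1 c1' !cenv1 // -ltNge.
rewrite /in_block; case: ifP => _; last by rewrite addn0 addr0.
rewrite sem_seq; set h2 := sem (CRSet _ _ _) h1.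
have env2 : input_env h2 by exact: input_env_sem.
split.
  rewrite storeE /= (gain_spec (c := c)) //.
  by rewrite /h2 sem_rset /= h1i.
rewrite (sem_agree _ _).2 //= storeE /=.
by rewrite (env_C env1) (env_y env1) (env_k env1) h1i j1.
Qed.
End Semantics.

(** * The table *)

Definition copy_cmd (b b' : nat) (dst src : nexp) : cmd :=
  CFor 11 size_k (CRSet b (NAdd dst (var 11)) (RGet b' (NAdd src (var 11)))).

(** All k entries of a list are copied, although only the first j are meaningful, to give the
    copying loop a static bound; entry j is then overwritten. *)
Definition relax_cmd : cmd :=
  CSeq (CNSet 12 0n (cell_n (var 6) (var 7) (var 9)))
  (CSeq (CNSet 13 0n
     (cell_n (NAdd (var 6) 1n) (var 8) (NAdd (var 9) (var 10))))
  (CIf (BAnd (NLe 1n (NGet 3 (var 12)))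
         (BNot (BAnd (NLe 1n (NGet 3 (var 13)))
            (RLe (RGet 5 (var 13)) (RAdd (RGet 5 (var 12)) (rvar 8))))))
     (CSeq (CNSet 3 (var 13) 1n)
     (CSeq (CRSet 5 (var 13) (RAdd (RGet 5 (var 12)) (rvar 8)))
     (CSeq (copy_cmd 6 6 (NMul (var 13) size_k) (NMul (var 12) size_k))
           (CRSet 6 (NAdd (NMul (var 13) size_k) (var 6)) (cand_ 8)))))
     CSkip)).

Definition extend_cmd (v : fairness) : cmd :=
  CIf (RLe (cand_ 7) (cand_ 8))
    (CSeq (weights_cmd v) (CFor 9 (NMul radix_n radix_n) relax_cmd))
    CSkip.

Definition table_cmd (v : fairness) : cmd :=
  CFor 6 size_k (CFor 7 cands_n (CFor 8 cands_n (extend_cmd v))).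

(** * Soundness and completeness of the dynamic program *)

Section Table.
Variables (R : realType) (v : fairness) (n k : nat) (y g : nat -> nat)
  (s C : nat -> R) (lambda : R).
Implicit Types h : memory R.

Local Notation input_env := (input_env n k y g s C lambda).
Local Notation cand := (cand n s).
Local Notation cand_env := (cand_env n s).
Local Notation delta := (delta n y g s v).
Local Notation kappa := (kappa n s (fun u j => C (y u * k + j)%N)).
Local Notation radix := (radix n).

(* The weight q is the most significant digit, so that cells do not overlap
   however large q is. *)
Definition cell (j c q : nat) : nat := ((q * (k + 1) + j) * (n + 2) + c)%N.

Lemma digits_inj b a r a' r' : (r < b)%N -> (r' < b)%N ->
  (a * b + r = a' * b + r')%N -> a = a' /\ r = r'.
Proof.
move=> rb rb' e; have b0 := leq_ltn_trans (leq0n _) rb.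
have := congr1 (modn^~ b) e; rewrite !modnMDl !modn_small // => er.
have := congr1 (divn^~ b) e; rewrite !divnMDl // !divn_small // !addn0 => ea.
by split.
Qed.

Lemma cell_inj j c q j' c' q' :
  (j <= k)%N -> (j' <= k)%N -> (c < n + 2)%N -> (c' < n + 2)%N ->
  cell j c q = cell j' c' q' -> [/\ j = j', c = c' & q = q'].
Proof.
move=> jk jk' cn cn' /(digits_inj cn cn')[+ ->].
by case/digits_inj; rewrite ?addn1 ?ltnS // => -> ->.
Qed.

Lemma neval_cell h j c q : input_env h ->
  neval h (cell_n j c q) = cell (neval h j) (neval h c) (neval h q).
Proof. by move=> env; rewrite /cell -(env_n env) -(env_k env). Qed.

(** Source and target may lie in the same array; disjoint ranges guarantee that entries still to be
    read have not been overwritten. The two addresses may depend on anything but the copy counter,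
    array 11. *)
Lemma copy_spec h b b' dst src :
  input_env h -> (2 < b)%N ->
  (forall h', (forall a i, (a != 11)%N -> nat_mem h' a i = nat_mem h a i) ->
     neval h' dst = neval h dst) ->
  (forall h', (forall a i, (a != 11)%N -> nat_mem h' a i = nat_mem h a i) ->
     neval h' src = neval h src) ->
  (forall i i', b = b' -> (i < k)%N -> (i' < k)%N ->
     neval h dst + i <> neval h src + i')%N ->
  let h1 := sem (copy_cmd b b' dst src) h in
  (forall i, (i < k)%N ->
     real_mem h1 b (neval h dst + i) = real_mem h b' (neval h src + i)) /\
  (forall a, (forall i, (i < k)%N -> a <> neval h dst + i)%N ->
     real_mem h1 b a = real_mem h b a).
Proof.
move=> env b2 ed es ne h1.
set d := neval h dst in ed ne *; set c := neval h src in es ne *.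
pose I i h1 := (forall i', (i' < i)%N ->
     real_mem h1 b (d + i')%N = real_mem h b' (c + i')%N) /\
  (forall a, (forall i', (i' < i)%N -> a <> d + i')%N ->
     real_mem h1 b a = real_mem h b a).
apply: (for_inv (I := I)) => //; first exact: env_k env.
move=> i h2 ik h2i [an ar] [I1 I2].
have en a j : (a != 11)%N -> nat_mem h2 a j = nat_mem h a j.
  by move=> na; rewrite an // inE.
have e1 : neval h2 dst = d by exact: ed.
have e2 : neval h2 src = c by exact: es.
have rd : real_mem h2 b' (c + i)%N = real_mem h b' (c + i)%N.
  have [eb|nb] := eqVneq b b'; last by rewrite ar // inE eq_sym.
  rewrite -eb I2 // => i' i'i; apply/nesym; apply: ne => //; exact: ltn_trans ik.
rewrite /I sem_rset /= h2i e1 e2 rd; split.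
  move=> i'; rewrite ltnS leq_eqVlt storeE eqxx /= eqn_add2l.
  by case: eqP => [->//|_] /= i'i; apply: I1.
move=> a na; rewrite storeE eqxx /=; case: eqP => [e|_].
  by case: (na i).
by apply: I2 => i' i'i; apply: na; rewrite ltnS ltnW.
Qed.

(** The Bellman inequality for the edge from candidate c in layer j to candidate c' in layer j +
    1. *)
Definition relaxed h j c c' q : Prop :=
  (0 < nat_mem h 3 (cell j c q))%N -> cand c <= cand c' ->
  let x' := cell j.+1 c' (q + delta (cand c) (cand c')) in
  (0 < nat_mem h 3 x')%N /\
  real_mem h 5 x' <= real_mem h 5 (cell j c q) + kappa j (cand c) (cand c').

Definition good (j : nat) (a : R) (q : nat) (x : R) (th : nat -> R) : Prop :=
  [/\ th 0%N = cand 0, th j = a, forall i, (i < j)%N -> th i <= th i.+1,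
      q = (\sum_(0 <= i < j) delta (th i) (th i.+1))%N
    & x = \sum_(0 <= i < j) kappa i (th i) (th i.+1)].

(** Every path starts at candidate 0, which is not stored; entry i of a list is therefore threshold
    i + 1. *)
Definition stored_path h (x i : nat) : R :=
  if i is i'.+1 then real_mem h 6 (x * k + i')%N else cand 0.

Definition sound h : Prop := forall j c q, (j <= k)%N -> (c < n + 2)%N ->
  (0 < nat_mem h 3 (cell j c q))%N ->
  good j (cand c) q (real_mem h 5 (cell j c q)) (stored_path h (cell j c q)).

(** The contract of every step of the round for layer j. Freezing the layers up to j protects the
    sources of relaxations already made. *)
Definition evolves j h h' : Prop :=
  [/\ sound h -> sound h',
      forall x, (0 < nat_mem h 3 x)%N ->
        (0 < nat_mem h' 3 x)%N /\ real_mem h' 5 x <= real_mem h 5 x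
    & forall j' c q, (j' <= j)%N -> (c < n + 2)%N ->
        nat_mem h' 3 (cell j' c q) = nat_mem h 3 (cell j' c q) /\
        real_mem h' 5 (cell j' c q) = real_mem h 5 (cell j' c q)].

Lemma evolves_refl j h : evolves j h h.
Proof. by split. Qed.

Lemma evolves_trans j h1 h2 h3 : evolves j h1 h2 -> evolves j h2 h3 -> evolves j h1 h3.
Proof.
move=> [s1 m1 e1] [s2 m2 e2]; split.
- by move/s1/s2.
- move=> x /m1[f2 l2]; have [f3 l3] := m2 _ f2; split=> //; exact: le_trans l2.
- move=> j' c q j'j cn; have [-> ->] := e2 j' c q j'j cn; exact: e1.
Qed.

(** The source is frozen and the target can only become cheaper. *)
Lemma relaxed_evolves j j' h h' c c' q : (j' <= j)%N -> (c < n + 2)%N ->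
  evolves j h h' -> relaxed h j' c c' q -> relaxed h' j' c c' q.
Proof.
move=> jj cn [_ m e] r; have [e3 e5] := e j' c q jj cn.
rewrite /relaxed e3 e5 => f le; have [f1 l1] := r f le.
have [f2 l2] := m _ f1; split=> //; exact: le_trans l2 l1.
Qed.

Lemma good_extend j a q x th b th' : good j a q x th -> a <= b ->
  (forall i, (i <= j)%N -> th' i = th i) -> th' j.+1 = b ->
  good j.+1 b (q + delta a b) (x + kappa j a b) th'.
Proof.
move=> [t0 tj le eq ex] ab et eb.
have ej : th' j = a by rewrite et.
split=> //; first by rewrite et.
- move=> i; rewrite ltnS leq_eqVlt => /orP[/eqP->|ij]; first by rewrite ej eb.
  by rewrite !et // ?le // ltnW.
- rewrite big_nat_recr //= ej eb eq; congr addn.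
  by apply: eq_big_nat => i /andP[_ ij]; rewrite !et // ltnW.
- rewrite big_nat_recr //= ej eb ex; congr (_ + _).
  by apply: eq_big_nat => i /andP[_ ij]; rewrite !et // ltnW.
Qed.
Lemma relax_spec h j c c' q :
  input_env h -> cand_env h -> (j < k)%N -> (c < n + 2)%N -> (c' < n + 2)%N ->
  nat_mem h 6 0 = j -> nat_mem h 7 0 = c -> nat_mem h 8 0 = c' ->
  nat_mem h 9 0 = q -> nat_mem h 10 0 = delta (cand c) (cand c') ->
  real_mem h 8 0 = kappa j (cand c) (cand c') -> cand c <= cand c' ->
  evolves j h (sem relax_cmd h) /\ relaxed (sem relax_cmd h) j c c' q.
Proof.
move=> env cenv jk cn cn' hj hc hc' hq hd hk le.
set S := cell j c q; set D := cell j.+1 c' (q + delta (cand c) (cand c')).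
have SD : S <> D by move=> /cell_inj[]//; lia.
rewrite /relax_cmd sem_seq; set h1 := sem (CNSet 12 _ _) h.
rewrite sem_seq; set h2 := sem (CNSet 13 _ _) h1.
have env1 : input_env h1 by exact: input_env_sem.
have env2 : input_env h2 by exact: input_env_sem.
have src : nat_mem h2 12 0 = S.
  rewrite -[LHS]/(neval h (cell_n (var 6) (var 7) (var 9))) neval_cell //=.
  by rewrite hj hc hq.
have dst : nat_mem h2 13 0 = D.
  rewrite -[LHS]/(neval h (cell_n (NAdd (var 6) 1n) (var 8) (NAdd (var 9) (var 10)))).
  by rewrite neval_cell //= hj hc' hq hd addn1.
have f2 x : nat_mem h2 3 x = nat_mem h 3 x by [].
have r2 a x : real_mem h2 a x = real_mem h a x by [].
have v2 : nat_mem h2 6 0 = j /\ nat_mem h2 8 0 = c' by [].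
case: v2 => hj2 hc2.
have ev2 : evolves j h h2 by exact: (evolves_refl j h).
clearbody h2; rewrite sem_if /= src dst !f2 !r2 hk.
(* Without an update, a flagged source means that the target is flagged and costs no more than the
   proposed path. *)
case: ifP => [/andP[fS nD]|up]; last first.
  split=> //.
  rewrite /relaxed !f2 !r2 -/S -/D => fS _; move: up; rewrite fS /= => /negbFE/andP[-> ->].
  by [].
rewrite sem_seq; set h3 := sem (CNSet _ _ _) h2.
rewrite sem_seq; set h4 := sem (CRSet _ _ _) h3.
have env3 : input_env h3 by exact: input_env_sem.
have env4 : input_env h4 by exact: input_env_sem.
have f4 x : nat_mem h4 3 x = if x == D then 1%N else nat_mem h 3 x.
  by rewrite /= storeE /= dst f2.
have n4 a x : (a != 3)%N -> nat_mem h4 a x = nat_mem h2 a x.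
  by move=> /negbTE na; rewrite /= storeE na /=.
have r5 x : real_mem h4 5 x =
    if x == D then real_mem h 5 S + kappa j (cand c) (cand c') else real_mem h 5 x.
  by rewrite /= storeE /= !storeE /= dst src r2 !r2 hk.
have r4 a x : (a != 5)%N -> real_mem h4 a x = real_mem h a x.
  by move=> /negbTE na; rewrite /= storeE na /= r2.
clearbody h4.
rewrite sem_seq; set h5 := sem (copy_cmd _ _ _ _) h4.
have env5 : input_env h5 by exact: input_env_sem.
have [a5n a5r] : agree (copy_cmd 6 6 (NMul (var 13) size_k) (NMul (var 12) size_k)) h4 h5.
  exact: sem_agree.
have k0 : (0 < k)%N by exact: leq_ltn_trans jk.
have [||||c1 c2] := copy_spec (h := h4) (b := 6%N) (b' := 6%N)
  (dst := NMul (var 13) size_k) (src := NMul (var 12) size_k) env4.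
- by [].
- by move=> h' e /=; rewrite !e.
- by move=> h' e /=; rewrite !e.
- move=> i i' _ ik ik' /=; rewrite (env_k env4) !n4 // src dst.
  by case/(digits_inj ik ik') => e _; exact: SD.
rewrite -/h5 /= (env_k env4) !n4 // src dst in c1 c2.
set h6 := sem _ h5.
have f6 x : nat_mem h6 3 x = if x == D then 1%N else nat_mem h 3 x.
  by rewrite /= a5n // f4.
have r56 x : real_mem h6 5 x =
    if x == D then real_mem h 5 S + kappa j (cand c) (cand c') else real_mem h 5 x.
  by rewrite /= storeE /= a5r // r5.
(* Lists occupy disjoint rows of length k, so only the row of D changes: it becomes the row of S
   with entry j replaced by the new threshold. *)
have r66 x i : (i < k)%N -> real_mem h6 6 (x * k + i)%N =
    if x == D then if i == j then cand c' else real_mem h 6 (S * k + i)%N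
    else real_mem h 6 (x * k + i)%N.
  move=> ik; rewrite /= storeE /= !a5n // !n4 // dst (env_k env2) hj2 hc2.
  rewrite a5r // r4 // cenv //.
  have [->|nx] := eqVneq x D.
    by rewrite eqn_add2l; case: eqP => // _; rewrite c1 // r4.
  case: eqP => [/(digits_inj ik jk)[e _]|_]; first by rewrite e eqxx in nx.
  rewrite c2 ?r4 // => i' ik' /(digits_inj ik ik')[e _].
  by rewrite e eqxx in nx.
clearbody h6; split; last first.
  rewrite /relaxed -/S -/D !f6 !r56 eqxx => _ _.
  by case: eqP => // _; rewrite lexx.
split.
(* The path at D is the path at S extended by [cand c']; every other cell keeps its path. *)
- move=> sd j' c0 q0 jk' cn0; rewrite f6 r56; have [e _|nD0] := eqVneq.
    move/cell_inj: (e) => []// -> -> ->; have := sd j c q (ltnW jk) cn fS.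
    rewrite -/S => gS; apply: good_extend gS le _ _.
    + case=> [//|i] ij; rewrite /stored_path -/D r66 ?eqxx; last exact: leq_trans ij (ltnW jk).
      by rewrite ltn_eqF.
    + by rewrite /stored_path -/D r66 // !eqxx.
  move=> f0; have [t0 tj tl tq tx] := sd _ _ _ jk' cn0 f0.
  have er i : (i <= j')%N -> stored_path h6 (cell j' c0 q0) i = stored_path h (cell j' c0 q0) i.
    case: i => [//|i] ij; rewrite /stored_path r66 ?(negbTE nD0) //; exact: leq_trans ij jk'.
  split=> //; first by rewrite er.
  + by move=> i ij; rewrite !er ?tl // ltnW.
  + by rewrite [LHS]tq; apply: eq_big_nat => i /andP[_ ij]; rewrite !er // ltnW.
  + by rewrite [LHS]tx; apply: eq_big_nat => i /andP[_ ij]; rewrite !er // ltnW.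
(* A target that was already flagged is overwritten only by a strictly smaller cost. *)
- move=> x fx; rewrite f6 r56; case: eqP => [xD|_]; last by [].
  split=> //; move: nD; rewrite negb_and -xD fx /= -ltNge; exact: ltW.
- move=> j' c0 q0 jj cn0; rewrite f6 r56; case: eqP => // /cell_inj[]//.
  + by apply: leq_trans jj (ltnW jk).
  + by move=> ej; rewrite ej ltnn in jj.
Qed.
Lemma evolves_nset j h x i a : x != 3%N -> evolves j h (nset h x i a).
Proof.
move=> x3; have e b : nat_mem (nset h x i a) 3 b = nat_mem h 3 b.
  by rewrite /= storeE eq_sym (negbTE x3).
split.
- by move=> sd j' c q jk cn; rewrite e; apply: sd.
- by move=> b; rewrite e.
- by move=> j' c q _ _; rewrite e.
Qed.

(** Loop rule for facts that persist as the table evolves: each round establishes its own, and the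
    later rounds preserve it. *)
Lemma evolves_for j x e N c h (P : nat -> memory R -> Prop) :
  neval h e = N -> x \notin nat_writes c -> x != 3%N ->
  (forall i h1 h2, evolves j h1 h2 -> P i h1 -> P i h2) ->
  (forall i h1, (i < N)%N -> nat_mem h1 x 0 = i -> agree (CFor x e c) h h1 ->
     evolves j h1 (sem c h1) /\ P i (sem c h1)) ->
  evolves j h (sem (CFor x e c) h) /\
  (forall i, (i < N)%N -> P i (sem (CFor x e c) h)).
Proof.
move=> eN xc x3 mono step.
pose I i h1 := evolves j h h1 /\ (forall i', (i' < i)%N -> P i' h1).
apply: (for_inv (I := I)) => //; first by split=> //; exact: evolves_nset.
move=> i h1 iN h1i ag [ev Pi]; have [ev1 Pi1] := step i h1 iN h1i ag.
have ev2 : evolves j (sem c h1) (nset (sem c h1) x 0 i.+1) by exact: evolves_nset.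
split; first exact: evolves_trans (evolves_trans ev ev1) ev2.
move=> i'; rewrite ltnS leq_eqVlt => /orP[/eqP->|/Pi]; first exact: mono Pi1.
by apply: mono; exact: evolves_trans ev2.
Qed.

Lemma cand_env_agree c h h' :
  agree c h h' -> 4%N \notin real_writes c -> cand_env h -> cand_env h'.
Proof. by move=> [_ ar] n4 cenv x xn; rewrite ar // cenv. Qed.

Definition relaxed_all j h : Prop := forall c c' q,
  (c < n + 2)%N -> (c' < n + 2)%N -> (q < radix * radix)%N -> relaxed h j c c' q.

Lemma relaxed_skip h j c c' q : cand c <= cand c' = false -> relaxed h j c c' q.
Proof. by move=> le _; rewrite le. Qed.

Lemma extend_spec h j c c' : input_env h -> cand_env h ->
  (j < k)%N -> (c < n + 2)%N -> (c' < n + 2)%N ->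
  nat_mem h 6 0 = j -> nat_mem h 7 0 = c -> nat_mem h 8 0 = c' ->
  evolves j h (sem (extend_cmd v) h) /\
  (forall q, (q < radix * radix)%N -> relaxed (sem (extend_cmd v) h) j c c' q).
Proof.
move=> env cenv jk cn cn' hj hc hc'.
rewrite /extend_cmd sem_if /= hc hc' !cenv //; case: ifP => le; last first.
  by split=> [|q _]; [exact: evolves_refl|exact: relaxed_skip].
have [wd wk] := weights_spec v env cenv hj hc hc' cn cn'.
rewrite sem_seq; set h1 := sem (weights_cmd v) h in wd wk *.
have ag : agree (weights_cmd v) h h1 by exact: sem_agree.
have env1 : input_env h1 by exact: input_env_sem.
have cenv1 := cand_env_agree ag isT cenv.
(* Computing the block weights does not touch the arrays 3, 5 and 6 of the table. *)
have ev1 : evolves j h h1.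
  split; [|by move=> x; rewrite ag.1 // ag.2
            |by move=> j' c0 q _ _; rewrite ag.1 // ag.2].
    move=> sd j' c0 q jk' cn0; rewrite ag.1 // ag.2 // /good /stored_path => f0.
    have [t0 tj tl tq tx] := sd _ _ _ jk' cn0 f0.
    have er i : stored_path h1 (cell j' c0 q) i = stored_path h (cell j' c0 q) i.
      by case: i => //= i; rewrite ag.2.
    split=> //; first by rewrite -tj; exact: er.
    + by move=> i ij; have := tl i ij; rewrite -!er.
    + by rewrite [LHS]tq; apply: eq_bigr => i _; rewrite -!er.
    + by rewrite [LHS]tx; apply: eq_bigr => i _; rewrite -!er.
have [|||||ev2 rl] := evolves_for (j := j) (x := 9%N) (h := h1)
    (e := NMul radix_n radix_n) (N := (radix * radix)%N) (c := relax_cmd)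
    (P := fun q h => relaxed h j c c' q).
- by rewrite /= (env_n env1).
- by [].
- by [].
- by move=> i h2 h3 ev; apply: relaxed_evolves ev.
- move=> q h2 qB h2q ag2; have env2 := input_env_agree ag2 isT env1.
  have cenv2 := cand_env_agree ag2 isT cenv1.
  by apply: relax_spec; rewrite // ?ag2.1 ?ag2.2 // ag.1.
by split=> //; exact: evolves_trans ev2.
Qed.

Lemma layer_spec h j : input_env h -> cand_env h -> (j < k)%N ->
  nat_mem h 6 0 = j ->
  let h1 := sem (CFor 7 cands_n (CFor 8 cands_n (extend_cmd v))) h in
  evolves j h h1 /\ relaxed_all j h1.
Proof.
move=> env cenv jk hj h1.
(* The bound on c is repeated inside the predicate because [evolves_for] asks for persistence at
   every index, and [relaxed_evolves] needs that bound. *)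
suff [ev rl] : evolves j h h1 /\ forall c, (c < n + 2)%N -> forall c' q,
    (c < n + 2)%N -> (c' < n + 2)%N -> (q < radix * radix)%N -> relaxed h1 j c c' q.
  by split=> // c c' q cn; apply: rl.
apply: (evolves_for (P := fun c h1 => forall c' q,
  (c < n + 2)%N -> (c' < n + 2)%N -> (q < radix * radix)%N -> relaxed h1 j c c' q)) => //.
  by rewrite /= (env_n env).
  move=> c h2 h3 ev rl c' q cn cn' qB; apply: relaxed_evolves ev _ => //; exact: rl.
move=> c h2 cn h2c ag2.
have env2 := input_env_agree ag2 isT env.
have cenv2 := cand_env_agree ag2 isT cenv.
suff [ev rl] : evolves j h2 (sem (CFor 8 cands_n (extend_cmd v)) h2) /\
    forall c', (c' < n + 2)%N -> forall q, (q < radix * radix)%N ->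
      relaxed (sem (CFor 8 cands_n (extend_cmd v)) h2) j c c' q.
  by split=> // c' q _ cn'; apply: rl.
apply: (evolves_for (P := fun c' h1 => forall q,
  (q < radix * radix)%N -> relaxed h1 j c c' q)) => //.
  by rewrite /= (env_n env2).
  move=> c' h3 h4 ev rl q qB; apply: relaxed_evolves ev _ => //; exact: rl.
move=> c' h3 cn' h3c ag3.
have env3 := input_env_agree ag3 isT env2.
have cenv3 := cand_env_agree ag3 isT cenv2.
by apply: extend_spec; rewrite // ag3.1 // ag2.1.
Qed.

(** The round for layer j changes no layer up to j, so the Bellman inequalities of the earlier
    rounds persist. *)
Lemma table_spec h : input_env h -> cand_env h -> sound h ->
  (0 < nat_mem h 3 (cell 0 0 0))%N -> real_mem h 5 (cell 0 0 0) <= 0 ->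
  let h1 := sem (table_cmd v) h in
  [/\ sound h1, (0 < nat_mem h1 3 (cell 0 0 0))%N,
      real_mem h1 5 (cell 0 0 0) <= 0
    & forall j, (j < k)%N -> relaxed_all j h1].
Proof.
move=> env cenv sd f0 x0.
pose I i h1 := [/\ sound h1, (0 < nat_mem h1 3 (cell 0 0 0))%N,
      real_mem h1 5 (cell 0 0 0) <= 0
    & forall j, (j < i)%N -> relaxed_all j h1].
apply: (for_inv (I := I)) => //; first exact: env_k env.
move=> j h1 jk hj ag [sd1 f1 x1 rl1].
have env1 := input_env_agree ag isT env.
have cenv1 := cand_env_agree ag isT cenv.
have [ev rl] := layer_spec env1 cenv1 jk hj; set h2 := sem _ h1 in ev rl *.
have ev' : evolves j h1 (nset h2 6 0 j.+1) by exact: ev.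
have [e1 e2 e3] := ev'; have [f2 x2] := e2 _ f1; split=> //.
- exact: e1.
- exact: le_trans x1.
- move=> j'; rewrite ltnS leq_eqVlt => /orP[/eqP->|j'j]; first exact: rl.
  move=> c c' q cn cn' qB; apply: relaxed_evolves ev' _ => //; first exact: ltnW.
  exact: rl1.
Qed.

(** The Bellman inequalities are summed along the path p, by induction on its length. *)
Lemma complete h p :
  (0 < nat_mem h 3 (cell 0 0 0))%N -> real_mem h 5 (cell 0 0 0) <= 0 ->
  (forall j, (j < k)%N -> relaxed_all j h) ->
  p 0 = 0%N -> (forall i, (i <= k)%N -> (p i < n + 2)%N) ->
  (forall i, (i < k)%N -> cand (p i) <= cand (p i.+1)) ->
  let q := (\sum_(0 <= i < k) delta (cand (p i)) (cand (p i.+1)))%N in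
  (q < radix * radix)%N ->
  (0 < nat_mem h 3 (cell k (p k) q))%N /\
  real_mem h 5 (cell k (p k) q) <=
    \sum_(0 <= i < k) kappa i (cand (p i)) (cand (p i.+1)).
Proof.
move=> f0 x0 rl p0 pn pl q qB.
suff H j : (j <= k)%N ->
    let q := (\sum_(0 <= i < j) delta (cand (p i)) (cand (p i.+1)))%N in
    (0 < nat_mem h 3 (cell j (p j) q))%N /\
    real_mem h 5 (cell j (p j) q) <=
      \sum_(0 <= i < j) kappa i (cand (p i)) (cand (p i.+1)) by exact: H.
elim: j => [_|j IH jk] q'; first by rewrite /q' !big_geq // p0.
have [f1 x1] := IH (ltnW jk).
rewrite /q' !big_nat_recr //=.
have [//||f2 x2] := rl j jk _ _ _ (pn j (ltnW jk)) (pn j.+1 jk) _ f1.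
(* Weights are natural numbers, so the weight of a prefix is at most the total and stays within the
   range of the loop over q. *)
- apply: leq_ltn_trans qB; rewrite /q [leqRHS](big_cat_nat (n := j)) //=.
    exact: leq_addr.
  exact: ltnW.
- exact: pl.
by split=> //; apply: le_trans x2 _; rewrite lerD2r.
Qed.
End Table.

(** * The final scan *)

Definition count_cmd (v : fairness) : cmd :=
  CSeq (CNSet 14 0n 0n) (CSeq (CNSet 15 0n 0n)
    (CFor 4 size_n (CFor 5 size_n (count_pair v 14 1n 15 1n)))).

Definition value_cmd : cmd :=
  CSeq (CRSet 10 0n (RSub (RDiv (ROfNat (var 16)) (ROfNat (var 14)))
                          (RDiv (ROfNat (var 17)) (ROfNat (var 15)))))
  (CSeq (CIf (RLe (ROfNat 0n) (rvar 10)) CSkip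
             (CRSet 10 0n (RSub (ROfNat 0n) (rvar 10))))
  (CRSet 10 0n (RAdd (RDiv (RGet 5 (var 12)) (ROfNat size_n))
                     (RMul (rvar 0) (rvar 10))))).

Definition record_cmd : cmd :=
  CSeq (CNSet 18 0n 1n) (CSeq (CRSet 9 0n (rvar 10))
    (copy_cmd 3 6 0n (NMul (var 12) size_k))).

(** Only paths ending at candidate n + 1, which stands for +oo, are complete. Scanning P and Q
    instead of q avoids decoding q by division. *)
Definition candidate_cmd : cmd :=
  CSeq (CNSet 12 0n (cell_n size_k (NAdd size_n 1n)
                       (NAdd (NMul (var 16) radix_n) (var 17))))
  (CIf (NLe 1n (NGet 3 (var 12)))
    (CSeq value_cmd
      (CIf (BAnd (NLe 1n (var 18)) (RLe (rvar 9) (rvar 10))) CSkip record_cmd))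
    CSkip).

Definition scan_cmd : cmd :=
  CSeq (CNSet 18 0n 0n) (CFor 16 radix_n (CFor 17 radix_n candidate_cmd)).

Section Scan.
Variables (R : realType) (v : fairness) (n k : nat) (y g : nat -> nat)
  (s C : nat -> R) (lambda : R).
Implicit Types h : memory R.

Local Notation input_env := (input_env n k y g s C lambda).
Local Notation radix := (radix n).

Definition total_pairs (p : nat -> nat -> bool) : nat :=
  (\sum_(0 <= u < n) \sum_(0 <= w < n) p u w)%N.

Local Notation pos_total := (total_pairs (pos_pair y g v)).
Local Notation neg_total := (total_pairs (neg_pair y g v)).

Lemma count_spec h : input_env h ->
  let h1 := sem (count_cmd v) h in
  nat_mem h1 14 0 = pos_total /\ nat_mem h1 15 0 = neg_total.
Proof.
move=> env h1; rewrite {}/h1 /count_cmd 2!sem_seq.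
set h0 := sem _ (sem _ h).
have env0 : input_env h0 by apply: input_env_sem => //; exact: input_env_sem.
pose I i h1 := nat_mem h1 14 0 = (\sum_(0 <= u < i) \sum_(0 <= w < n) pos_pair y g v u w)%N /\
  nat_mem h1 15 0 = (\sum_(0 <= u < i) \sum_(0 <= w < n) neg_pair y g v u w)%N.
apply: (for_inv (I := I)) => //; first exact: env_n env0.
  by split; rewrite big_geq.
move=> u h1 un h1u ag [I1 I2]; have env1 := input_env_agree ag isT env0.
rewrite /I !big_nat_recr //= -I1 -I2 !storeE /=.
pose J i h2 := nat_mem h2 14 0 = (nat_mem h1 14 0 + \sum_(0 <= w < i) pos_pair y g v u w)%N /\
  nat_mem h2 15 0 = (nat_mem h1 15 0 + \sum_(0 <= w < i) neg_pair y g v u w)%N.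
apply: (for_inv (I := J)) => //; first exact: env_n env1.
  by split; rewrite big_geq //= addn0.
move=> w h2 wn h2w ag2 [J1 J2]; have env2 := input_env_agree ag2 isT env1.
have h2u : nat_mem h2 4 0 = u by rewrite ag2.1.
rewrite /J !big_nat_recr //= !addnA -J1 -J2 !storeE /= /count_pair sem_seq.
set h3 := sem (CIf (pos_test v) _ _) h2.
have env3 : input_env h3 by exact: input_env_sem.
have ag3 : agree (CIf (pos_test v) (CNSet 14 0n (NAdd (var 14) 1n)) CSkip) h2 h3.
  exact: sem_agree.
rewrite count_if_spec (neg_testE v env3) !ag3.1 // h2u h2w mul1n; split=> //.
rewrite (sem_agree _ _).1 // /h3 count_if_spec (pos_testE v env2) h2u h2w.
by rewrite mul1n.
Qed.

(** If a total is 0, its quotient is 0, in accordance with the convention for null events in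
    [condPr2]. *)
Definition value (P Q : nat) (x : R) : R :=
  x / n%:R + lambda * `|P%:R / pos_total%:R - Q%:R / neg_total%:R|.

Definition final_cell (P Q : nat) : nat := cell n k k (n + 1) (P * radix + Q).

Definition final_value h (P Q : nat) : R :=
  value P Q (real_mem h 5 (final_cell P Q)).

(** Scan invariant: [S] holds the pairs seen so far and h is the memory before the scan. The
    attaining pair is only asked to be below [radix], so the second half does not change as [S]
    grows. *)
Definition best_of h (S : nat -> nat -> Prop) h1 : Prop :=
  (forall P Q, S P Q -> (0 < nat_mem h 3 (final_cell P Q))%N ->
     (0 < nat_mem h1 18 0)%N /\ real_mem h1 9 0 <= final_value h P Q) /\
  ((0 < nat_mem h1 18 0)%N -> exists P Q,
     [/\ (P < radix)%N && (Q < radix)%N, (0 < nat_mem h 3 (final_cell P Q))%N,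
         real_mem h1 9 0 = final_value h P Q
       & forall i, (i < k)%N ->
           real_mem h1 3 i = real_mem h 6 (final_cell P Q * k + i)%N]).

Definition same_table h h1 : Prop :=
  [/\ forall x, nat_mem h1 3 x = nat_mem h 3 x,
      forall x, real_mem h1 5 x = real_mem h 5 x
    & forall x, real_mem h1 6 x = real_mem h 6 x].

Lemma value_spec h P Q x : input_env h ->
  nat_mem h 16 0 = P -> nat_mem h 17 0 = Q ->
  nat_mem h 14 0 = pos_total -> nat_mem h 15 0 = neg_total ->
  nat_mem h 12 0 = x ->
  real_mem (sem value_cmd h) 10 0 = value P Q (real_mem h 5 x).
Proof.
move=> env hP hQ hZ1 hZ2 hx.
rewrite /value_cmd sem_seq; set h1 := sem _ h.
have v1 : real_mem h1 10 0 = P%:R / pos_total%:R - Q%:R / neg_total%:R.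
  by rewrite -hP -hQ -hZ1 -hZ2.
have x1 : nat_mem h1 12 0 = x by [].
have r1 : real_mem h1 5 x = real_mem h 5 x by [].
have env1 : input_env h1 by exact: input_env_sem.
clearbody h1; rewrite sem_seq; set h2 := sem _ h1.
have v2 : real_mem h2 10 0 = `|real_mem h1 10 0|.
  rewrite /h2 sem_if /=; case: ifP => [le|]; first by rewrite sem_skip ger0_norm.
  by rewrite /= storeE /= sub0r => /negbT; rewrite -ltNge => lt; rewrite ltr0_norm.
have ag : agree (CIf (RLe (ROfNat 0n) (rvar 10)) CSkip
             (CRSet 10 0n (RSub (ROfNat 0n) (rvar 10)))) h1 h2 by exact: sem_agree.
have env2 : input_env h2 by exact: input_env_sem.
rewrite sem_rset /= storeE /= v2 v1 ag.1 // x1 ag.2 // r1.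
by rewrite (env_n env2) (env_lambda env2).
Qed.

Lemma candidate_spec h S h1 P Q : input_env h1 -> same_table h h1 ->
  nat_mem h1 16 0 = P -> nat_mem h1 17 0 = Q ->
  nat_mem h1 14 0 = pos_total -> nat_mem h1 15 0 = neg_total ->
  (P < radix)%N -> (Q < radix)%N -> best_of h S h1 ->
  best_of h (fun P' Q' => S P' Q' \/ P' = P /\ Q' = Q) (sem candidate_cmd h1).
Proof.
move=> env [s3 s5 s6] hP hQ hZ1 hZ2 PW QW [B1 B2].
rewrite /candidate_cmd sem_seq; set h2 := sem _ h1.
have env2 : input_env h2 by exact: input_env_sem.
have x2 : nat_mem h2 12 0 = final_cell P Q.
  rewrite -[LHS]/(neval h1 (cell_n size_k (NAdd size_n 1n)
                       (NAdd (NMul (var 16) radix_n) (var 17)))).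
  by rewrite (neval_cell _ _ _ env) /= hP hQ (env_n env) (env_k env).
have n2 a i : (a != 12)%N -> nat_mem h2 a i = nat_mem h1 a i.
  by move=> /negbTE na; rewrite /= storeE na.
have r2 a i : real_mem h2 a i = real_mem h1 a i by [].
clearbody h2; rewrite sem_if /= x2 n2 // s3; case: ifP => fx; last first.
  rewrite sem_skip.
  split; last by rewrite n2 // => /B2[P' [Q' [? ? ? e]]]; exists P', Q'; split=> // [|i ik];
    rewrite r2 // e.
  by move=> P' Q' [/B1 b /b|[-> ->]]; [rewrite n2 // r2|rewrite fx].
rewrite sem_seq; set h3 := sem value_cmd h2.
have env3 : input_env h3 by exact: input_env_sem.
have v3 : real_mem h3 10 0 = final_value h P Q.
  rewrite (value_spec (P := P) (Q := Q) env2 _ _ _ _ x2) //; do ?by rewrite n2.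
  by rewrite r2 s5.
have ag3 : agree value_cmd h2 h3 by exact: sem_agree.
have n3 a i : (a != 12)%N -> nat_mem h3 a i = nat_mem h1 a i.
  by move=> na; rewrite ag3.1 // n2.
have r3 a i : (a != 10)%N -> real_mem h3 a i = real_mem h1 a i.
  by move=> na; rewrite ag3.2 ?inE ?(negbTE na).
have x3 : nat_mem h3 12 0 = final_cell P Q by rewrite ag3.1.
clearbody h3; rewrite sem_if /= v3 n3 // r3 //; case: ifP => [/andP[f le]|nle].
  rewrite sem_skip.
  split; last by rewrite n3 // => /B2[P' [Q' [? ? ? e]]]; exists P', Q'; split=> // [|i ik];
    rewrite r3 // e.
  by move=> P' Q' [/B1 b /b|[-> ->] _]; rewrite n3 // r3.
rewrite /record_cmd !sem_seq; set h4 := sem (CRSet _ _ _) _.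
have env4 : input_env h4 by apply: input_env_sem => //; exact: input_env_sem.
have f4 : nat_mem h4 18 0 = 1%N by [].
have b4 : real_mem h4 9 0 = final_value h P Q by rewrite -v3.
have x4 : nat_mem h4 12 0 = final_cell P Q by rewrite -x3.
have r4 i : real_mem h4 6 i = real_mem h 6 i by rewrite -s6 -r3.
clearbody h4; set h5 := sem _ h4.
have ag5 : agree (copy_cmd 3 6 0n (NMul (var 12) size_k)) h4 h5 by exact: sem_agree.
have f5 : nat_mem h5 18 0 = 1%N by rewrite ag5.1.
have b5 : real_mem h5 9 0 = final_value h P Q by rewrite ag5.2.
have [||||c5 _] := copy_spec (h := h4) (b := 3%N) (b' := 6%N) (dst := 0n)
  (src := NMul (var 12) size_k) env4; try by [].
  by move=> h' e /=; rewrite !e.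
split=> [P' Q' SP' fP'|_].
  rewrite f5 b5; split=> //; case: SP' fP' => [/B1 b /b[f le]|[-> -> _ //]].
  by move/negbT: nle; rewrite f /= -ltNge => /ltW lt; apply: le_trans le.
exists P, Q; split=> //; first by rewrite PW.
move=> i ik; have := c5 i ik; rewrite /= add0n (env_k env4) x4 r4.
by [].
Qed.

Lemma scan_spec h : input_env h ->
  nat_mem h 14 0 = pos_total -> nat_mem h 15 0 = neg_total ->
  best_of h (fun P Q => (P < radix)%N /\ (Q < radix)%N) (sem scan_cmd h).
Proof.
move=> env hZ1 hZ2; rewrite /scan_cmd sem_seq; set h0 := sem _ h.
have env0 : input_env h0 by exact: input_env_sem.
have [z1 z2] : nat_mem h0 14 0 = pos_total /\ nat_mem h0 15 0 = neg_total by [].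
have st0 : same_table h h0 by [].
have f0 : nat_mem h0 18 0 = 0%N by [].
clearbody h0.
pose I i h1 := best_of h (fun P Q => (P < i)%N /\ (Q < radix)%N) h1.
apply: (for_inv (I := I)) => //.
- by rewrite /= (env_n env0).
- by split=> [P Q [//]|]; rewrite /= storeE /= f0.
move=> P h1 PW h1P ag1 I1; have env1 := input_env_agree ag1 isT env0.
have st1 : same_table h h1.
  by case: st0 => s3 s5 s6; split=> x; rewrite ?ag1.1 ?ag1.2.
have z11 : nat_mem h1 14 0 = pos_total by rewrite ag1.1.
have z21 : nat_mem h1 15 0 = neg_total by rewrite ag1.1.
(* The pairs seen so far are those lexicographically below (P, i). *)
pose J i h2 := best_of h (fun P' Q => (P' < P)%N /\ (Q < radix)%N \/ P' = P /\ (Q < i)%N) h2.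
suff [J1 J2] : J radix (sem (CFor 17 radix_n candidate_cmd) h1).
  split; last exact: J2.
  move=> P' Q' [P'P Q'W]; apply: J1; move: P'P.
  by rewrite ltnS leq_eqVlt => /orP[/eqP->|P'P]; [right|left].
apply: (for_inv (I := J)) => //.
- by rewrite /= (env_n env1).
- by case: I1 => J1 J2; split=> // P' Q' [|[_ //]]; exact: J1.
move=> Q h2 QW h2Q ag2 J2; have env2 := input_env_agree ag2 isT env1.
have [|||||//|//||K1 K2] := candidate_spec (S := fun P' Q' => (P' < P)%N /\ (Q' < radix)%N
   \/ P' = P /\ (Q' < Q)%N) (h := h) (P := P) (Q := Q) env2.
- by case: st1 => s3 s5 s6; split=> x; rewrite ?ag2.1 ?ag2.2.
- by rewrite ag2.1.
- by [].
- by rewrite ag2.1.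
- by rewrite ag2.1.
- exact: J2.
split; last exact: K2.
move=> P' Q' SP'; apply: K1; case: SP' => [?|[-> ]]; first by left; left.
by rewrite ltnS leq_eqVlt => /orP[/eqP->|Q'Q]; [right|left; right].
Qed.
End Scan.

(** * Fairness violations and predictions *)

Lemma nth_allpairs (S T U : Type) (x0 : U) (s0 : S) (t0 : T) (f : S -> T -> U)
    (s : seq S) (t : seq T) i j : (i < size s)%N -> (j < size t)%N ->
  nth x0 [seq f x y | x <- s, y <- t] (i * size t + j) = f (nth s0 s i) (nth t0 t j).
Proof.
elim: s i => [//|a s IH] [|i] /= si tj; rewrite nth_cat size_map.
  by rewrite add0n tj (nth_map t0).
by rewrite mulSn -addnA ltnNge leq_addr /= addKn IH.
Qed.

Lemma card_pairs n (p : 'I_n -> 'I_n -> bool) :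
  #|[set z : 'I_n * 'I_n | p z.1 z.2]| = (\sum_(u < n) \sum_(w < n) p u w)%N.
Proof.
rewrite pair_bigA /= -sum1_card big_mkcond; apply: eq_bigr => z _.
by rewrite inE; case: (p _ _).
Qed.

Lemma condPr2E (R : realType) n (E F : {set 'I_n * 'I_n}) : (0 < n)%N ->
  condPr2 R E F = #|E :&: F|%:R / #|F|%:R.
Proof.
move=> n0; rewrite /condPr2 /Pr2 invfM invrK mulrACA mulVf ?mulr1 //.
by rewrite pnatr_eq0 expn_eq0 andbT -lt0n.
Qed.

Lemma condPr2_pairs (R : realType) n (p q : 'I_n -> 'I_n -> bool) : (0 < n)%N ->
  condPr2 R [set z : 'I_n * 'I_n | p z.1 z.2] [set z | q z.1 z.2] =
  (\sum_(u < n) \sum_(w < n) (p u w && q u w))%:R /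
  (\sum_(u < n) \sum_(w < n) q u w)%:R.
Proof.
move=> n0; rewrite condPr2E //; congr (_%:R / _%:R); last exact: card_pairs.
apply: etrans (card_pairs (fun u w => p u w && q u w)).
by apply: eq_card => z; rewrite !inE.
Qed.

Section Violation.
Variables (R : realType) (v : fairness) (A : finType) (d k n : nat)
  (D : dataset R d k A n) (f : 'rV[R]_d -> 'I_k).
Hypothesis n0 : (0 < n)%N.

Local Notation fx u := (f (feature D u)).

Definition comparable_labels (u w : 'I_n) : bool :=
  if v is EO then (label D w < label D u)%N else true.

Definition in_groups (a b : A) (u w : 'I_n) : bool :=
  [&& group D u == a, group D w == b & comparable_labels u w].

Definition dominance (a b : A) : R :=
  (\sum_(u < n) \sum_(w < n) ((fx w < fx u)%N && in_groups a b u w))%:R /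
  (\sum_(u < n) \sum_(w < n) in_groups a b u w)%:R.

(* Exchanging the two samples turns the second conditional probability for
   (a, b) into the first one for (b, a). *)
Lemma fair_violE :
  fair_viol v f D =
  \big[Num.max/0]_(p : A * A) `|dominance p.1 p.2 - dominance p.2 p.1|.
Proof.
have E1 (a b : A) (q : 'I_n -> 'I_n -> bool) : q =2 in_groups a b ->
    condPr2 R [set z : 'I_n * 'I_n | (fx z.1 > fx z.2)%N]
      [set z | q z.1 z.2] = dominance a b.
  move=> qE; rewrite (condPr2_pairs R (fun u w => fx w < fx u)%N q n0) /dominance.
  by congr (_%:R / _%:R); apply: eq_bigr => u _; apply: eq_bigr => w _; rewrite qE.
have E2 (a b : A) (q : 'I_n -> 'I_n -> bool) : (forall u w, q u w = in_groups b a w u) ->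
    condPr2 R [set z : 'I_n * 'I_n | (fx z.1 < fx z.2)%N]
      [set z | q z.1 z.2] = dominance b a.
  move=> qE; rewrite (condPr2_pairs R (fun u w => fx u < fx w)%N q n0) /dominance.
  by congr (_%:R / _%:R); rewrite exchange_big /=; apply: eq_bigr => u _;
    apply: eq_bigr => w _; rewrite qE.
move: E1 E2; rewrite /fair_viol /in_groups /comparable_labels; case: v => E1 E2;
  apply: eq_bigr => -[a b] _; congr (`| _ - _ |).
- by apply: (E1 _ _ (fun u w => (group D u == a) && (group D w == b))) => u w; rewrite andbT.
- apply: (E2 _ _ (fun u w => (group D u == a) && (group D w == b))) => u w.
  by rewrite andbT andbC.
- by apply: (E1 _ _ (fun u w => [&& group D u == a, group D w == b
    & (label D u > label D w)%N])).
- apply: (E2 _ _ (fun u w => [&& group D u == a, group D w == b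
    & (label D u < label D w)%N])) => u w.
  by rewrite andbCA.
Qed.

(** Pairs of equal groups contribute 0 to the maximum, and the two mixed pairs contribute the same
    absolute value. *)
Lemma fair_viol_two (a0 a1 : A) : (forall a, a = a0 \/ a = a1) ->
  fair_viol v f D = `|dominance a0 a1 - dominance a1 a0|.
Proof.
move=> two; rewrite fair_violE; apply/le_anti/andP; split.
  apply: bigmax_le => // -[a b] _ /=.
  by case: (two a) => ->; case: (two b) => ->; rewrite ?subrr ?normr0 // distrC.
exact: (le_bigmax_cond _ (fun p : A * A => `|dominance p.1 p.2 - dominance p.2 p.1|)
  (j := (a0, a1))).
Qed.
End Violation.

(** * Predictions by finite block bounds *)

Section Thresholds.
Variables (R : realType) (T : Type) (m : nat) (sc : T -> R).
Variables (theta : 'I_m -> R) (th : nat -> R).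

Lemma predict_block x : nondecreasing_thresholds theta ->
  th 0 < sc x -> sc x <= th m.+1 ->
  (forall j : 'I_m, (sc x <= theta j) = (sc x <= th j.+1)) ->
  in_block (th (threshold_predict sc theta x))
    (th (threshold_predict sc theta x).+1) (sc x).
Proof.
move=> nd lo hi e; set l := threshold_predict _ _ _.
have /andP[] : (bound theta l < (sc x)%:E <= bound theta l.+1)%E.
  by rewrite -(threshold_predictP sc x l nd).
rewrite /in_block; case: l => -[|l] lm lo' hi' /=; apply/andP; split=> //.
- move: hi'; rewrite /bound; case: insubP => [j _ /= jE|/=]; first by rewrite lee_fin e jE.
  by rewrite -leqNgt leqn0 => /eqP e0 _; move: hi; rewrite e0.
- move: lo'; rewrite /bound /=; case: insubP => [j _ /= jE|].
    by rewrite lte_fin !ltNge e jE.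
  by have := lm; rewrite ltnS => ->.
- move: hi'; rewrite /bound /=; case: insubP => [j _ /= jE|/=]; first by rewrite lee_fin e jE.
  rewrite -leqNgt => ml _; have := lm; rewrite ltnS leq_eqVlt ltnNge ml orbF => /= /eqP e0.
  by rewrite e0.
Qed.
End Thresholds.

(** * Rounding thresholds down to candidates *)

Section Snap.
Variables (R : realType) (n : nat) (s : nat -> R).
Local Notation cand := (cand n s).

Definition snap (t : R) : 'I_n.+1 :=
  [arg max_(c > ord0 | (val c == 0%N) || (cand c <= t)) cand c]%O.

Lemma snap_le t t' : t <= t' -> cand (snap t) <= cand (snap t').
Proof.
move=> tt; rewrite /snap; case: arg_maxP => //= c Pc _.
case: arg_maxP => //= c' _; apply.
by case/orP: Pc => [->//|/le_trans->//]; rewrite orbT.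
Qed.

(** If [s u <= t], then [s u] itself competes in the maximum. Conversely the maximum is at most t,
    unless it is at index 0, whose candidate lies strictly below [s u]. *)
Lemma snapP t u : (u < n)%N -> (s u <= t) = (s u <= cand (snap t)).
Proof.
move=> un; rewrite /snap; case: arg_maxP => //= c Pc max.
have cu : cand u.+1 = s u by rewrite /= un.
apply/idP/idP => [ut|uc].
  have un1 : (u.+1 < n.+1)%N by [].
  by have := max (Ordinal un1); rewrite cu; apply.
case/orP: Pc => [/eqP c0|]; last exact: le_trans.
by move: uc; rewrite c0 leNgt; have /andP[->] := outerP s un.
Qed.
End Snap.

(** * Correctness *)

Definition optimize_cmd (v : fairness) : cmd :=
  CSeq init_cmd (CSeq (table_cmd v) (CSeq (count_cmd v) scan_cmd)).

Section Correctness.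
Variables (R : realType) (A : finType) (v : fairness) (lambda : R)
  (n d m : nat) (D : dataset R d m.+1 A n) (s : 'rV[R]_d -> R) (C : 'M[R]_m.+1).
Hypotheses (hA : #|A| = 2%N) (n0 : (0 < n)%N).

Let h0 := input_memory lambda D s C.
Let y := nat_mem h0 1.
Let g := nat_mem h0 2.
Let sc := real_mem h0 1.
Let Cc := real_mem h0 2.
Local Notation cost := (fun u j => Cc (y u * m.+1 + j)%N).
Local Notation cand := (cand n sc).
Local Notation pos := (pos_pair y g v).
Local Notation neg := (neg_pair y g v).

Lemma input_labelE (u : 'I_n) : y u = label D u.
Proof. by rewrite /y /= /arrays /= (nth_map u) ?size_enum_ord // nth_ord_enum. Qed.

Lemma input_groupE (u : 'I_n) : g u = enum_rank (group D u).
Proof. by rewrite /g /= /arrays /= (nth_map u) ?size_enum_ord // nth_ord_enum. Qed.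

Lemma input_scoreE (u : 'I_n) : sc u = s (feature D u).
Proof. by rewrite /sc /= /arrays /= (nth_map u) ?size_enum_ord // nth_ord_enum. Qed.

Lemma input_costE (i j : 'I_m.+1) : Cc (i * m.+1 + j)%N = C i j.
Proof.
have := nth_allpairs 0 i j (fun i j => C i j) (s := enum 'I_m.+1) (t := enum 'I_m.+1)
  (i := i) (j := j).
by rewrite /Cc /= /arrays /= size_enum_ord !nth_ord_enum => ->.
Qed.

Definition predicted (theta : 'I_m -> R) (u : nat) : nat :=
  if insub u is Some i then threshold_predict s theta (feature D i) else 0%N.

Lemma predictedE theta (u : 'I_n) :
  predicted theta u = threshold_predict s theta (feature D u).
Proof. by rewrite /predicted valK. Qed.

Lemma pair_countE (p : nat -> nat -> bool) theta (q : 'I_n -> 'I_n -> bool) :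
  (forall u w : 'I_n, p u w = q u w) ->
  pair_count n p (predicted theta) =
  (\sum_(u < n) \sum_(w < n)
    ((threshold_predict s theta (feature D w) < threshold_predict s theta (feature D u))%N
     && q u w))%N.
Proof.
move=> pq; rewrite /pair_count big_mkord; apply: eq_bigr => u _.
rewrite big_mkcond big_mkord; apply: eq_bigr => w _.
by rewrite !predictedE pq; case: ifP.
Qed.

Lemma total_pairsE (p : nat -> nat -> bool) (q : 'I_n -> 'I_n -> bool) :
  (forall u w : 'I_n, p u w = q u w) ->
  total_pairs n p = (\sum_(u < n) \sum_(w < n) q u w)%N.
Proof.
move=> pq; rewrite /total_pairs big_mkord; apply: eq_bigr => u _.
by rewrite big_mkord; apply: eq_bigr => w _; rewrite pq.
Qed.

Lemma objectiveE theta :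
  objective v lambda D s C theta =
  value v n y g lambda (pair_count n pos (predicted theta))
    (pair_count n neg (predicted theta))
    (\sum_(0 <= u < n) cost u (predicted theta u)).
Proof.
have r0 : (0 < #|A|)%N by rewrite hA.
have r1 : (1 < #|A|)%N by rewrite hA.
(* The two groups in the order in which the input encodes them as 0 and 1. *)
pose a0 : A := enum_val (Ordinal r0); pose a1 : A := enum_val (Ordinal r1).
have e0 a : (enum_rank a == 0%N :> nat) = (a == a0).
  by rewrite -(inj_eq enum_rank_inj) enum_valK.
have e1 a : (enum_rank a == 1%N :> nat) = (a == a1).
  by rewrite -(inj_eq enum_rank_inj) enum_valK.
have two a : a = a0 \/ a = a1.
  have := ltn_ord (enum_rank a); rewrite [X in (_ < X)%N -> _]hA ltnS leq_eqVlt ltnS leqn0.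
  by rewrite e0 e1 => /orP[/eqP|/eqP]; [right|left].
have cE (u w : 'I_n) : comparable_pair y v u w = comparable_labels v D u w.
  by rewrite /comparable_pair /comparable_labels !input_labelE.
have pE (u w : 'I_n) : pos u w = in_groups v D a0 a1 u w.
  by rewrite /pos_pair !input_groupE e0 e1 cE.
have nE (u w : 'I_n) : neg u w = in_groups v D a1 a0 u w.
  by rewrite /neg_pair !input_groupE e0 e1 cE.
rewrite /objective (fair_viol_two _ _ _ n0 two) /value mulrC; congr (_ / _ + _ * _).
  by rewrite big_mkord; apply: eq_bigr => u _; rewrite predictedE input_labelE input_costE.
by rewrite (pair_countE _ pE) (pair_countE _ nE) (total_pairsE pE) (total_pairsE nE).
Qed.

(** Applied to the rounded path of an arbitrary theta, and to the stored path that is output. *)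
Lemma objective_path theta (th : nat -> R) :
  nondecreasing_thresholds theta ->
  th 0%N = cand 0 -> th m.+1 = cand (n + 1) ->
  (forall i, (i < m.+1)%N -> th i <= th i.+1) ->
  (forall (j : 'I_m) u, (u < n)%N -> (sc u <= theta j) = (sc u <= th j.+1)) ->
  objective v lambda D s C theta =
    value v n y g lambda (pair_count n pos (predicted theta))
      (pair_count n neg (predicted theta))
      (\sum_(0 <= j < m.+1) kappa n sc cost j (th j) (th j.+1)) /\
  (\sum_(0 <= j < m.+1) delta n y g sc v (th j) (th j.+1) =
   pair_count n pos (predicted theta) * radix n
     + pair_count n neg (predicted theta))%N.
Proof.
move=> nd t0 tk tl te.
have fP u : (u < n)%N -> (predicted theta u < m.+1)%N &&
    in_block (th (predicted theta u)) (th (predicted theta u).+1) (sc u).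
  move=> un; have /andP[lo hi] := outerP sc un.
  rewrite -[u]/(val (Ordinal un)) predictedE input_scoreE ltn_ord /=.
  apply: predict_block => //.
  - by rewrite -input_scoreE t0.
  - by rewrite -input_scoreE tk addn1 /= ltnn.
  - by move=> j; rewrite -input_scoreE te.
by rewrite objectiveE (sum_kappa _ tl fP) (sum_delta _ _ _ tl fP).
Qed.

(** Candidates 0 and n + 1 take the places of -oo and +oo. *)
Definition snapped (theta : 'I_m -> R) (i : nat) : nat :=
  if i is j.+1 then
    if insub j is Some j' then snap n sc (theta j') else (n + 1)%N
  else 0%N.

Lemma cand_range c : cand 0 <= cand c <= cand (n + 1).
Proof.
have o0 : - outer n sc <= outer n sc.
  have /andP[l r] := outerP sc n0; exact: le_trans (ltW l) r.
rewrite addn1 /= ltnn; case: c => [|c] /=; first by rewrite lexx.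
by case: ifP => [/(outerP sc)/andP[/ltW-> ->]//|_]; rewrite o0 lexx.
Qed.

Lemma snapped_path theta : nondecreasing_thresholds theta ->
  [/\ forall i, (snapped theta i < n + 2)%N, snapped theta m.+1 = (n + 1)%N,
      forall i, (i < m.+1)%N ->
        cand (snapped theta i) <= cand (snapped theta i.+1)
    & forall (j : 'I_m) u, (u < n)%N ->
        (sc u <= theta j) = (sc u <= cand (snapped theta j.+1))].
Proof.
move=> nd; split.
- case=> [|i] /=; first by rewrite addn2.
  case: insub => [j|]; last by rewrite addn1 addn2.
  by apply: leq_trans (ltn_ord _) _; rewrite addn2 leqnSn.
- by rewrite /snapped insubF // ltnn.
- case=> [|i] im; first by have /andP[] := cand_range (snapped theta 1).
  rewrite /snapped; case: insubP => [j' jm jE|/negP[]//].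
  case: insubP => [j'' _ jE'|_]; last by have /andP[] := cand_range (snap n sc (theta j')).
  by apply: snap_le; apply: nd; rewrite jE jE'.
- by move=> j u un; rewrite /snapped valK; exact: snapP.
Qed.

(** Two facts about the recorded value: it is at most the objective of every theta, whose rounded
    path the table covers, and it equals the objective of the output, by soundness of the table. *)
Lemma optimize_correct :
  optimal_thresholds v lambda D s C
    (@output_thresholds R m (sem (optimize_cmd v) h0)).
Proof.
have env0 : input_env n m.+1 y g sc Cc lambda h0 by split.
rewrite /optimize_cmd 3!sem_seq.
have [env1 cenv1 f1 ag1] := init_spec env0.
have f1' x : nat_mem (sem init_cmd h0) 3 x = (x == 0)%N.
  by rewrite f1 /h0 /= /arrays nth_nil; case: eqP.
have x1 : real_mem (sem init_cmd h0) 5 0 = 0 by rewrite ag1.2 // /h0 /= /arrays nth_nil.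
set h1 := sem init_cmd h0 in env1 cenv1 f1' x1 *.
have c0 : cell n m.+1 0 0 0 = 0%N by [].
(* The only flagged cell is 0, which by injectivity of [cell] encodes the empty path. *)
have sd1 : sound v n m.+1 y g sc Cc h1.
  move=> j c q jk cn; rewrite f1' lt0b => /eqP e0.
  have [|-> -> ->] := cell_inj (n := n) (k := m.+1) jk (leq0n _) cn _ (etrans e0 (esym c0)).
    by rewrite addn2.
  by split=> //; rewrite big_geq // c0.
have [||sd2 f2 x2 rl] := table_spec env1 cenv1 sd1; rewrite ?c0 ?f1' ?x1 //.
have env2 : input_env n m.+1 y g sc Cc lambda (sem (table_cmd v) h1).
  exact: input_env_sem.
have cenv2 : cand_env n sc (sem (table_cmd v) h1).
  by apply: cand_env_agree (sem_agree _ _) _ cenv1.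
set h2 := sem (table_cmd v) h1 in sd2 f2 x2 rl env2 cenv2 *.
have [z1 z2] := count_spec v env2.
have env3 : input_env n m.+1 y g sc Cc lambda (sem (count_cmd v) h2).
  exact: input_env_sem.
have ag3 : agree (count_cmd v) h2 (sem (count_cmd v) h2) by exact: sem_agree.
set h3 := sem (count_cmd v) h2 in z1 z2 env3 ag3 *.
have [lower found] := scan_spec env3 z1 z2.
set h4 := sem scan_cmd h3 in lower found *.
have fin P Q : nat_mem h3 3 (final_cell n m.+1 P Q) = nat_mem h2 3 (final_cell n m.+1 P Q) /\
    final_value v n m.+1 y g lambda h3 P Q = final_value v n m.+1 y g lambda h2 P Q.
  by rewrite /final_value ag3.1 // ag3.2.
have attained theta : nondecreasing_thresholds theta ->
    (0 < nat_mem h4 18 0)%N /\ real_mem h4 9 0 <= objective v lambda D s C theta.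
  move=> nd; have [pn pk pl pe] := snapped_path nd.
  have [//||oE eq] := objective_path (th := fun i => cand (snapped theta i)) nd _ _ pl pe.
    by rewrite pk.
  rewrite {}oE; set P := pair_count n pos _ in eq *; set Q := pair_count n neg _ in eq *.
  have PW : (P < radix n)%N by exact: pair_count_lt.
  have QW : (Q < radix n)%N by exact: pair_count_lt.
  have [//||f x] := complete (p := snapped theta) f2 x2 rl _ (fun i _ => pn i) pl.
    (* Both digits are below [radix], so the weight P * radix + Q is below radix^2. *)
    rewrite eq; apply: leq_trans (_ : P * radix n + radix n <= _)%N.
      by rewrite ltn_add2l.
    by rewrite addnC -mulSn leq_mul2r PW orbT.
  rewrite eq pk in f x.
  have [e3 eV] := fin P Q.
  have [|l1 l2] := lower P Q (conj PW QW); first by rewrite e3.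
  split=> //; apply: le_trans l2 _; rewrite eV /final_value /value lerD2r.
  by apply: ler_wpM2r x; rewrite invr_ge0 ler0n.
(* The zero thresholds are admissible, so some solution has been recorded. *)
have f18 : (0 < nat_mem h4 18 0)%N.
  by have [] := attained (fun _ => 0).
have [P [Q [/andP[PW QW] fPQ bE out]]] := found f18.
have [e3 eV] := fin P Q; rewrite e3 in fPQ; rewrite eV in bE.
have n12 : (n + 1 < n + 2)%N by rewrite ltn_add2l.
have [t0 tk tl tq tx] := sd2 _ _ _ (leqnn _) n12 fPQ.
set th := stored_path _ _ _ _ _ in t0 tk tl tq tx.
have thE (j : 'I_m) : output_thresholds h4 j = th j.+1.
  rewrite /output_thresholds out; last exact: ltnW (ltn_ord j).
  by rewrite ag3.2.
have nd : nondecreasing_thresholds (@output_thresholds R m h4).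
  move=> i j ij; rewrite !thE; apply: (thresholds_le tl).
  by rewrite ltnS ij /= ltnS ltnW.
have [oE qE] := objective_path nd t0 tk tl (fun j u _ => congr1 (fun t => sc u <= t) (thE j)).
split=> // theta /attained[_]; apply: le_trans.
(* The weight of the output path is the scanned P * radix + Q; uniqueness of digits identifies its
   pair counts with P and Q. *)
rewrite bE oE -tx; move: qE; rewrite -tq => /digits_inj[||<- <-] //.
exact: pair_count_lt.
Qed.
End Correctness.

Theorem proposition2 (R : realType) (A : finType) (hA : #|A| = 2%N)
    (v : fairness) :
  exists (p : prog) (c : nat),
  forall (lambda : R) (n d m : nat) (D : dataset R d m.+1 A n)
         (s : 'rV[R]_d -> R) (C : 'M[R]_m.+1),
    0 <= lambda ->
    (0 < n)%N ->
    (forall i j : 'I_m.+1, 0 <= C i j) ->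
    V_shaped_cost_matrix C ->
    exists (t : nat) (h : memory R),
      [/\ exec p (input_memory lambda D s C) t h,
          (t <= c * (n ^ 6 * m.+1 ^ 3))%N
        & optimal_thresholds v lambda D s C (@output_thresholds R m h)].
Proof.
(* The constant is the coefficient of the monomial bound and, like the program, depends on v
   alone. *)
exists (compile (optimize_cmd v)), (time_bound (optimize_cmd v)).1.1.
move=> lambda n d m D s C _ n0 _ _.
have wf : well_formed (optimize_cmd v) by [].
(* By computation: each of the two candidate loops contributes one factor n, and the loop over q
   contributes n^4. *)
have dn : ((time_bound (optimize_cmd v)).1.2 <= 6)%N by case: (v).
have dk : ((time_bound (optimize_cmd v)).2 <= 3)%N by case: (v).
have [t ex le] := compile_exec n0 (ltn0Sn m) (h := input_memory lambda D s C) wf erefl erefl.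
exists t, (sem (optimize_cmd v) (input_memory lambda D s C)); split=> //.
  apply: leq_trans le _; rewrite leq_mul2l; apply/orP; right.
  by apply: leq_mul; apply: leq_pexp2l.
exact: optimize_correct.
Qed.
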